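(* Let $\gamma>0$ and let $\mu$ be a distribution on $\mathbb{R}$ with $\widehat\mu(\gamma)<\infty$ and $\widehat\mu(\gamma+iz)\neq0$ for every $z\in\mathbb{R}$. If $\mu^{n*}\in\mathcal{S}(\gamma)$ for some $n\in\mathbb{N}$, then $\mu\in\mathcal{S}(\gamma)$.
   Context: For a probability distribution $\rho$ on $\mathbb{R}$: $\bar\rho(x):=\rho((x,\infty))$, $\rho^{n*}$ is the $n$-th convolution power, $\widehat\rho(\gamma):=\int e^{\gamma x}\rho(dx)$, and when $\widehat\rho(\gamma)<\infty$, $\widehat\rho(\gamma+iz):=\int e^{(\gamma+iz)x}\rho(dx)$ for $z\in\mathbb{R}$. $f\sim g$ means $f(x)/g(x)\to1$ as $x\to\infty$. For $\gamma\ge0$: $\rho\in\mathcal{L}(\gamma)$ if $\bar\rho(x)>0$ for all $x$ and $\bar\rho(x+a)\sim e^{-\gamma a}\bar\rho(x)$ for every $a\in\mathbb{R}$; $\rho\in\mathcal{S}(\gamma)$ if $\rho\in\mathcal{L}(\gamma)$, $\widehat\rho(\gamma)<\infty$ and $\overline{\rho^{2*}}(x)\sim2\widehat\rho(\gamma)\bar\rho(x)$. *)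

(* Defs.v *)
From HB Require Import structures.
From mathcomp Require Import all_boot all_order all_algebra.
From mathcomp Require Import all_classical all_reals all_analysis.
Set Implicit Arguments. Unset Strict Implicit. Unset Printing Implicit Defensive.
Import Order.TTheory GRing.Theory Num.Theory.
Import numFieldNormedType.Exports.
Local Open Scope classical_set_scope.
Local Open Scope ring_scope.

Section Defs.
Variable R : realType.

Fixpoint convpow (mu : probability R R) (n : nat) : set R -> \bar R :=
  match n with
  | 0 => fun A => (\1_A (0 : R))%:E
  | n.+1 => fun A => (\int[mu]_y convpow mu n ((fun x : R => (x + y)%R) @^-1` A))%E
  end.

Definition conv (rho : set R -> \bar R) (nu : probability R R) : set R -> \bar R :=
  fun A => (\int[nu]_y rho ((fun x : R => (x + y)%R) @^-1` A))%E.

Definition tail (rho : set R -> \bar R) (x : R) : R := fine (rho `]x, +oo[%classic).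

Definition asym_equiv (f g : R -> R) : Prop :=
  (fun x => f x / g x) @ +oo --> (1 : R).

Definition mgf (rho : probability R R) (g : R) : \bar R :=
  (\int[rho]_x (expR (g * x))%:E)%E.

(* real and imaginary parts of \hat rho(gamma + i z) *)
Definition cmgf_re (rho : probability R R) (g z : R) : R :=
  fine (\int[rho]_x (expR (g * x) * cos (z * x))%:E)%E.
Definition cmgf_im (rho : probability R R) (g z : R) : R :=
  fine (\int[rho]_x (expR (g * x) * sin (z * x))%:E)%E.

Definition classL (g : R) (rho : probability R R) : Prop :=
  (forall x, 0 < tail rho x) /\
  (forall a, asym_equiv (fun x => tail rho (x + a)) (fun x => expR (- g * a) * tail rho x)).

Definition classS (g : R) (rho : probability R R) : Prop :=
  classL g rho /\ (mgf rho g < +oo)%E /\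
  asym_equiv (tail (conv rho rho)) (fun x => 2 * fine (mgf rho g) * tail rho x).

End Defs.

(* Main.v *)
Require Import Defs.
From HB Require Import structures.
From mathcomp Require Import all_boot all_order all_algebra.
From mathcomp Require Import all_classical all_reals all_analysis.
From mathcomp Require Import measurable_realfun ring lra.
Import Order.TTheory GRing.Theory Num.Theory.
Import numFieldNormedType.Exports.
Local Open Scope classical_set_scope.
Local Open Scope ring_scope.

(** Write f(x) for the ratio of the tails of mu and rho = mu^{n*}. Membership of
    rho in S(gamma) is the principle of a single big jump: conditionally on the sum
    of two independent variables with tails O(rho's tail) being large, all but one of them
    stay bounded. Iterating it gives n f * nu -> 1, where nu(dy) = e^{gamma y}
    mu^{(n-1)*}(dy) is a finite measure whose Fourier transform never vanishes, and
    f decreases slowly because mu's tail is monotone. A Wiener-Pitt theorem then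
    yields f -> c > 0, so the tails of mu and rho are proportional and mu is in S(gamma).

    The Wiener-Pitt theorem is proved without Banach algebras. If g is bounded and
    g * nu -> 0, demodulate at a frequency z and smooth: a = (g cos(z.)) * k and
    b = (g sin(z.)) * k, with k a Fejer kernel of band width 1/x. The pair (a, b) is
    reproduced by a de la Vallee-Poussin kernel, hence varies on the scale x, so that
    convolving it with nu almost amounts to multiplying a - ib by nu's Fourier
    transform at z; as the latter is nonzero, limsup |a - ib| is at most half of
    itself. Averaging over z in [0, lam] shows that g * (k . k') -> 0 for k' the Fejer
    kernel of band width lam, which is an approximate identity as lam grows. *)

(** Nothing is known beforehand about the regularity of mu's tail, so class L(gamma) can be applied
    only to rho. A shift by y therefore produces f (x - y) times e^{gamma y} rather than a limit,
    which is why the outcome is an equation for f and not a formula. Three facts make the equation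
    solvable: f is nonnegative; it is bounded, since the other factors of rho exceed some fixed
    level with positive probability; and f (x + t) <= (1 + e) f x for small t >= 0 and large x, a
    one-sided regularity. The parameters of the Wiener-Pitt argument are chosen in a fixed order: a
    width d from the one-sided bound, lam from d, the minimum of the squared modulus of the
    transform on [0, lam], and last x. Hence the concentration of the product kernel has to be
    uniform in x >= 1. In place of limsups there are bounds valid for large u, which start from a
    trivial one and are halved repeatedly. Complex numbers appear as pairs of cosine and sine
    integrals. *)

Local Notation "m .-itg f" := (m.-integrable setT (EFin \o f)) (at level 2).

(** * Lebesgue measure on the line and affine changes of variable *)

Section Lebesgue.
Variable R : realType.

Let idR : measurableTypeR R -> R := idfun.

(* [lebesgue_measure] lives on [measurableTypeR R], a structure on R distinct from the
   one carrying [probability R R]; [leb] transports it to the latter. *)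
Definition leb : set R -> \bar R := pushforward lebesgue_measure idR.

Let midR : measurable_fun setT idR.
Proof. by move=> _ Y mY; rewrite setTI. Qed.

HB.instance Definition _ := Measure.copy leb
  (measure_function_pushforward__canonical__measure_function_Measure lebesgue_measure midR).

Lemma leb_sigma_finite : sigma_finite setT leb.
Proof. exact: (sigma_finiteT (@lebesgue_measure R)). Qed.

HB.instance Definition _ := Measure_isSigmaFinite.Build _ _ _ leb leb_sigma_finite.

Lemma integrable_leb (D : set R) (f : R -> R) : measurable D -> measurable_fun setT f ->
  leb.-integrable D (EFin \o f) <-> lebesgue_measure.-integrable D (EFin \o f).
Proof.
move=> mD mf; split=> /integrableP[h1 h2]; apply/integrableP.
  split => //; rewrite ge0_integral_pushforward// in h2.
  exact: measurableT_comp.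
split => //; rewrite ge0_integral_pushforward//.
exact: measurableT_comp.
Qed.

Lemma Rintegral_leb (D : set R) (f : R -> R) : measurable D -> measurable_fun setT f ->
  leb.-integrable D (EFin \o f) ->
  \int[leb]_(x in D) f x = \int[lebesgue_measure]_(x in D) f x.
Proof.
move=> mD mf fi; rewrite /Rintegral integral_pushforward//.
  exact/measurable_EFinP.
by apply/integrable_leb.
Qed.

Lemma measurable_affine (s t : R) : measurable_fun setT (fun x : R => s * x + t).
Proof. by apply: measurable_funD => //; apply: measurable_funM. Qed.

(** Uniqueness of Lebesgue measure: the pushforward scaled by [|s|] has the right value on every
    []a, b]]. A negative [s] exchanges the ends, so the two signs give half-open intervals of
    opposite kinds. *)
Lemma leb_affine (s t : R) (A : set R) : s != 0 -> measurable A ->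
  leb ((fun x => s * x + t) @^-1` A) = (`|s|^-1%:E * leb A)%E.
Proof.
move=> s0 mA.
have maff : measurable_fun (setT : set (measurableTypeR R))
   ((fun x => s * x + t) : measurableTypeR R -> measurableTypeR R).
  exact: measurable_affine.
pose k : {nonneg R} := NngNum (normr_ge0 s).
pose nu : {measure set (measurableTypeR R) -> \bar R} := 
  mscale k (measure_function_pushforward__canonical__measure_function_Measure lebesgue_measure maff).
have : leb A = nu A.
  apply: lebesgue_measure_unique => // _ [[a b]] _ <-.
  change (lebesgue_measure `]a, b]%classic =
     (`|s|%:E * lebesgue_measure ((fun x : R => (s * x + t)%R) @^-1` `]a, b]%classic)))%E.
  have [{}s0|{}s0|s0'] := ltgtP s 0; last by rewrite s0' eqxx in s0.
  - rewrite [X in (_ * lebesgue_measure X)%E](_ : _ = 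
       `[(b - t) / s, (a - t) / s[%classic); last first.
      apply/seteqP; split => x /=; rewrite !in_itv/= ler_ndivrMr// ltr_ndivlMr// => /andP[h1 h2];
       apply/andP; split; lra.
    rewrite !lebesgue_measure_itv/= !lte_fin ltr_ndivrMr// mulfVK ?lt_eqF//.
    rewrite ltrBlDr subrK.
    case: ifP; rewrite ?mule0// => _; rewrite -!EFinD -EFinM ltr0_norm//; congr EFin.
    by field; rewrite lt_eqF.
  - rewrite [X in (_ * lebesgue_measure X)%E](_ : _ = 
       `](a - t) / s, (b - t) / s]%classic); last first.
      apply/seteqP; split => x /=; rewrite !in_itv/= ltr_pdivrMr// ler_pdivlMr// => /andP[h1 h2];
       apply/andP; split; lra.
    rewrite !lebesgue_measure_itv/= !lte_fin ltr_pdivrMr// mulfVK ?gt_eqF//.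
    rewrite ltrBlDr subrK.
    case: ifP; rewrite ?mule0// => _; rewrite -!EFinD -EFinM gtr0_norm//; congr EFin.
    by field; rewrite gt_eqF.
have -> : nu A = (`|s|%:E * leb ((fun x : R => (s * x + t)%R) @^-1` A))%E by [].
by move=> ->; rewrite muleA -EFinM mulVf ?normr_eq0// mul1e.
Qed.

Lemma ge0_integral_leb_affine (s t : R) (f : R -> \bar R) : s != 0 ->
  measurable_fun setT f -> (forall x, 0 <= f x)%E ->
  (\int[leb]_x f (s * x + t)%R = `|s|^-1%:E * \int[leb]_x f x)%E.
Proof.
move=> s0 mf f0.
have sV0 : 0 <= `|s|^-1 by rewrite invr_ge0.
pose k : {nonneg R} := NngNum sV0.
rewrite -(ge0_integral_mscale _ measurableT k)//.
transitivity (\int[measure_function_pushforward__canonical__measure_function_Measure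
    leb (measurable_affine s t)]_x f x)%E.
  by rewrite (ge0_integral_pushforward (measurable_affine s t)).
by apply: eq_measure_integral => /= A mA _; exact: leb_affine.
Qed.

Lemma integrable_leb_affine (s t : R) (f : R -> R) : s != 0 ->
  leb.-integrable setT (EFin \o f) ->
  leb.-integrable setT (EFin \o (fun x => f (s * x + t))).
Proof.
move=> s0 /integrableP[mf fi]; apply/integrableP; split.
  apply: measurableT_comp => //; apply: (measurableT_comp (f := f)).
    exact/measurable_EFinP.
  exact: measurable_affine.
rewrite (@ge0_integral_leb_affine s t (fun x => `|(f x)%:E|)%E)//; last first.
  exact: measurableT_comp.
by rewrite lte_mul_pinfty// lee_fin invr_ge0.
Qed.

Lemma Rintegral_leb_affine (s t : R) (f : R -> R) : s != 0 ->
  leb.-integrable setT (EFin \o f) ->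
  \int[leb]_x f (s * x + t) = `|s|^-1 * \int[leb]_x f x.
Proof.
move=> s0 fi; have /integrableP[mf _] := fi.
have fs := integrable_leb_affine s t f s0 fi.
have p1 := integrable_pos_fin_num measurableT fs.
have p2 := integrable_neg_fin_num measurableT fs.
have p3 := integrable_pos_fin_num measurableT fi.
have p4 := integrable_neg_fin_num measurableT fi.
rewrite /Rintegral integralE [in RHS]integralE (fineB p1 p2) (fineB p3 p4).
rewrite mulrBr; congr (_ - _).
- transitivity (fine (\int[leb]_x ((EFin \o f)^\+ (s * x + t)%R)%E)).
    by congr fine; apply: eq_integral => x _; rewrite !funeposE.
  rewrite (@ge0_integral_leb_affine s t (EFin \o f)^\+%E)// ?fineM//.
  exact: measurable_funepos.
- transitivity (fine (\int[leb]_x ((EFin \o f)^\- (s * x + t)%R)%E)).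
    by congr fine; apply: eq_integral => x _; rewrite !funenegE.
  rewrite (@ge0_integral_leb_affine s t (EFin \o f)^\-%E)// ?fineM//.
    exact: measurable_funeneg.
Qed.

(** The dominating function for all kernels of the proof. *)
Lemma integrable_invr1Dsqr : leb.-integrable setT (EFin \o (fun x : R => (1 + x ^+ 2)^-1)).
Proof.
have mf : measurable_fun setT (fun x : R => (1 + x ^+ 2)^-1).
  apply: continuous_measurable_fun; exact: continuous_oneDsqrV.
have f0 (x : R) : 0 <= (1 + x ^+ 2)^-1 by rewrite invr_ge0 addr_ge0// sqr_ge0.
apply/integrable_leb => //.
apply/integrableP; split; first exact/measurable_EFinP.
under eq_integral do rewrite /= ger0_norm//.
rewrite ge0_symfun_integralT//.
- rewrite -set_itvcy integral0y_oneDsqr -EFinM ltry//.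
- exact: continuous_oneDsqrV.
- by move=> x /=; rewrite sqrrN.
Qed.
End Lebesgue.
Arguments leb {R}.

(** * Real-valued Lebesgue integrals *)

Section Rint.
Context {d} {T : measurableType d} {R : realType}.
Implicit Types (m : {measure set T -> \bar R}) (f g h k : T -> R).

Lemma itg_measurable m f : m.-itg f -> measurable_fun setT f.
Proof. by move=> /integrableP[/measurable_EFinP]. Qed.

Lemma itg_le m f h : measurable_fun setT f -> m.-itg h ->
  (forall x, `|f x| <= h x) -> m.-itg f.
Proof.
move=> mf hi fh; apply: le_integrable hi => //; first exact/measurable_EFinP.
by move=> x _ /=; rewrite lee_fin (le_trans (fh x))// ler_norm.
Qed.

Lemma itg_norm m f : m.-itg f -> m.-itg (fun x => `|f x|).
Proof. exact: integrable_norm. Qed.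

Lemma itgZ m f c : m.-itg f -> m.-itg (fun x => c * f x).
Proof. by move=> fi; exact: (integrableZl measurableT c fi). Qed.

Lemma itgD m f g : m.-itg f -> m.-itg g -> m.-itg (fun x => f x + g x).
Proof. by move=> fi gi; exact: (integrableD measurableT fi gi). Qed.

Lemma itgB m f g : m.-itg f -> m.-itg g -> m.-itg (fun x => f x - g x).
Proof. by move=> fi gi; exact: (integrableB measurableT fi gi). Qed.

Lemma itg_bddM m g k A : m.-itg k -> measurable_fun setT g ->
  (forall x, `|g x| <= A) -> m.-itg (fun x => g x * k x).
Proof.
move=> ki mg gA; have mk := itg_measurable _ _ ki.
apply: (itg_le _ _ (fun x => A * `|k x|)).
- exact: measurable_funM.
- exact/itgZ/itg_norm.
- by move=> x; rewrite normrM ler_wpM2r.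
Qed.

Lemma itg_bdd (P : probability T R) f A : measurable_fun setT f ->
  (forall x, `|f x| <= A) -> P.-itg f.
Proof.
move=> mf fA; apply: (itg_le _ _ (cst A)) => //.
exact: finite_measure_integrable_cst.
Qed.

Lemma Rint_le m f g : m.-itg f -> m.-itg g -> (forall x, f x <= g x) ->
  \int[m]_x f x <= \int[m]_x g x.
Proof. by move=> fi gi fg; apply: le_Rintegral. Qed.

Lemma Rint_norm_le m f h : measurable_fun setT f -> m.-itg h ->
  (forall x, `|f x| <= h x) -> `|\int[m]_x f x| <= \int[m]_x h x.
Proof.
move=> mf hi fh; have fi := itg_le _ _ _ mf hi fh.
by apply: le_trans (le_normr_Rintegral measurableT fi) _; apply: Rint_le => //; exact: itg_norm.
Qed.

Lemma Rint_dct m (F : nat -> T -> R) f h : (forall n, measurable_fun setT (F n)) ->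
  (forall t, F n t @[n --> \oo] --> f t) -> m.-itg h ->
  (forall n t, `|F n t| <= h t) ->
  \int[m]_t F n t @[n --> \oo] --> \int[m]_t f t.
Proof.
move=> mF Ff hi Fh.
have mf : measurable_fun setT f.
  by apply: (measurable_fun_cvg (h := F)) => // t _; exact: Ff.
have fh t : `|f t| <= h t.
  by apply: (ler_cvg_to (cvg_norm (Ff t)) (cvg_cst (h t))); exact: nearW.
have fi := itg_le _ _ _ mf hi fh.
apply: fine_cvg; rewrite fineK; last exact: (integrable_fin_num measurableT fi).
apply: (@dominated_cvg _ _ _ m setT measurableT (fun n x => (F n x)%:E) (EFin \o f) (EFin \o h)) => //.
- by move=> n; exact/measurable_EFinP.
- by move=> x _; apply: cvg_EFin; [exact: nearW|exact: Ff].
- by move=> n x _; rewrite /= lee_fin.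
Qed.

(** Limits at +oo are tested along sequences; each sequence is shifted past the threshold, so that
    domination for large [x] only is enough. *)
Lemma Rint_dct_pinfty m (F : R -> T -> R) f h :
  (forall x, measurable_fun setT (F x)) ->
  (forall t, F x t @[x --> +oo] --> f t) -> m.-itg h ->
  (\forall x \near +oo, forall t, `|F x t| <= h t) ->
  \int[m]_t F x t @[x --> +oo] --> \int[m]_t f t.
Proof.
move=> mF Ff hi [X [_ Fh]]; apply/cvg_pinftyP => u uy.
have [N _ uN] : \forall n \near \oo, X < u n by move/cvgryPgt : uy; apply.
rewrite -(cvg_shiftn N); apply: (Rint_dct _ _ _ h) => //.
- by move=> t; rewrite (cvg_shiftn N (fun n => F (u n) t)); move/cvg_pinftyP : (Ff t); apply.
- by move=> n t; apply: Fh; apply: uN => /=; rewrite leq_addl.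
Qed.

End Rint.

(** * Fubini's theorem for real-valued integrals *)

Section Fubini.
Context {d1 d2} {T1 : measurableType d1} {T2 : measurableType d2} {R : realType}.
Implicit Types (mu : {sigma_finite_measure set T1 -> \bar R})
  (nu : {sigma_finite_measure set T2 -> \bar R}) (F : T1 * T2 -> R).

Lemma itg_prod mu nu f g : mu.-itg f -> nu.-itg g ->
  (mu \x nu)%E.-itg (fun z => f z.1 * g z.2).
Proof.
move=> fi gi; have mf := itg_measurable _ _ fi; have mg := itg_measurable _ _ gi.
apply/integrable12ltyP.
  apply/measurable_EFinP; apply: measurable_funM; exact: measurableT_comp.
under eq_integral => x _.
  under eq_integral => y _ do rewrite /= normrM EFinM.
  rewrite ge0_integralZl//; last first.
    by apply/measurable_EFinP; apply: measurableT_comp.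
  over.
rewrite ge0_integralZr//.
- by rewrite lte_mul_pinfty ?integral_ge0//; [apply/integrable_fin_num => //; exact: itg_norm|
   have /integrableP[_] := gi].
- by apply/measurable_EFinP; apply: measurableT_comp.
- by rewrite integral_ge0.
Qed.

Lemma measurable_Rint nu F : measurable_fun setT F ->
  measurable_fun setT (fun x => \int[nu]_y F (x, y)).
Proof.
move=> mF; apply: measurableT_comp => //.
under eq_fun do rewrite integralE.
apply: emeasurable_funB.
- rewrite (_ : (fun _ => _) = fubini_F nu (EFin \o F)^\+%E).
    apply: measurable_fun_fubini_tonelli_F => //.
    by apply: measurable_funepos; exact/measurable_EFinP.
  by apply/funext => x; apply: eq_integral => y _; rewrite !funeposE.
- rewrite (_ : (fun _ => _) = fubini_F nu (EFin \o F)^\-%E).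
    apply: measurable_fun_fubini_tonelli_F => //.
    by apply: measurable_funeneg; exact/measurable_EFinP.
  by apply/funext => x; apply: eq_integral => y _; rewrite !funenegE.
Qed.

Lemma itg_swap mu nu F : (mu \x nu)%E.-itg F -> (nu \x mu)%E.-itg (fun z => F (z.2, z.1)).
Proof.
move=> Fi; have mF := itg_measurable _ _ Fi; apply/integrable21ltyP.
  apply/measurable_EFinP; apply: (measurableT_comp mF).
  exact: measurable_fun_pair.
have mF' : measurable_fun setT (EFin \o F) by exact/measurable_EFinP.
by move: Fi => /(integrable12ltyP mu nu mF').
Qed.

(** [Rintegral] goes through [fine], which sends infinite values to 0. Sections of an integrable
    function are integrable only almost everywhere, so the real and the extended inner integrals can
    be identified only almost everywhere. *)
Lemma ae_fin_Rint mu nu F : (mu \x nu)%E.-itg F ->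
  {ae mu, forall x, (\int[nu]_y F (x, y))%:E = (\int[nu]_y (F (x, y))%:E)%E}.
Proof.
move=> Fi; apply: filterS (ae_integrable1 Fi) => x Fx.
by rewrite fineK//; exact: integrable_fin_num.
Qed.

Lemma itg_Rint mu nu F : (mu \x nu)%E.-itg F -> mu.-itg (fun x => \int[nu]_y F (x, y)).
Proof.
move=> Fi; have /integrableP[_ h] := integrable_fubini_F Fi.
apply/integrableP; split.
  by apply/measurable_EFinP; apply: measurable_Rint; exact: itg_measurable Fi.
apply: le_lt_trans h; rewrite le_eqVlt; apply/orP; left; apply/eqP.
have mF := itg_measurable _ _ Fi.
apply: ae_eq_integral => //.
- by apply: measurableT_comp => //; apply/measurable_EFinP/measurable_Rint.
- by apply: measurableT_comp => //; exact: (measurable_fubini_F Fi).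
- by apply: filterS (ae_fin_Rint _ _ _ Fi) => x Fx _; exact: (congr1 abse Fx).
Qed.

Lemma Rint_Rint mu nu F : (mu \x nu)%E.-itg F ->
  \int[mu]_x \int[nu]_y F (x, y) = \int[(mu \x nu)%E]_z F z.
Proof.
move=> Fi; rewrite /Rintegral -(integral12_prod_meas1 Fi); congr fine.
have mF := itg_measurable _ _ Fi.
apply: ae_eq_integral => //.
- by apply/measurable_EFinP/measurable_Rint.
- exact: (measurable_fubini_F Fi).
- by apply: filterS (ae_fin_Rint _ _ _ Fi) => x Fx _; exact: Fx.
Qed.

End Fubini.

Section Fubini_swap.
Context {d1 d2} {T1 : measurableType d1} {T2 : measurableType d2} {R : realType}.
Implicit Types (mu : {sigma_finite_measure set T1 -> \bar R})
  (nu : {sigma_finite_measure set T2 -> \bar R}) (F : T1 * T2 -> R).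

Lemma Rint_fubini mu nu F : (mu \x nu)%E.-itg F ->
  \int[mu]_x \int[nu]_y F (x, y) = \int[nu]_y \int[mu]_x F (x, y).
Proof.
move=> Fi; rewrite Rint_Rint//; have := Rint_Rint _ _ _ (itg_swap _ _ _ Fi) => /= ->.
rewrite /Rintegral; congr fine.
rewrite -(integral12_prod_meas1 Fi) -(integral21_prod_meas1 (itg_swap _ _ _ Fi)).
by [].
Qed.

End Fubini_swap.

Section pinfty.
Context {R : realType}.
Implicit Types (f g : R -> R) (l a : R).

Lemma cvgyP f l : f x @[x --> +oo] --> l <->
  forall e, 0 < e -> exists X, forall x, X < x -> `|f x - l| <= e.
Proof.
split=> [/cvgrPdist_le h e e0|h].
  by have [X [_ hX]] := h _ e0; exists X => x Xx; rewrite distrC; exact: hX.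
apply/cvgrPdist_le => e e0; have [X hX] := h e e0.
by exists X; split; [exact: num_real|move=> x Xx; rewrite distrC; exact: hX].
Qed.

Lemma cvgy_shift f l a : f x @[x --> +oo] --> l -> f (x + a) @[x --> +oo] --> l.
Proof.
move=> /cvgyP h; apply/cvgyP => e e0; have [X hX] := h e e0.
by exists (X - a) => x Xx; apply: hX; lra.
Qed.

End pinfty.

(** * Convolution with an integrable density *)

Section wconv.
Context {R : realType}.
Implicit Types (m n : {sigma_finite_measure set R -> \bar R}) (f g h k : R -> R).

(** Convolution of [g] with the signed measure of density [k] with respect to [m]. The base measure
    is a parameter because smoothing kernels are Lebesgue densities, whereas exponential weights are
    densities with respect to a probability. *)
Definition wconv m k g x := \int[m]_y (g (x - y) * k y).

Lemma measurable_reflect g x : measurable_fun setT g -> measurable_fun setT (fun y : R => g (x - y)).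
Proof. by move=> mg; apply: (measurableT_comp mg); exact: measurable_funB. Qed.

Lemma measurable_sub2 g : measurable_fun setT g -> measurable_fun setT (fun z : R * R => g (z.1 - z.2)).
Proof. by move=> mg; apply: (measurableT_comp mg); exact: measurable_funB. Qed.

Lemma wconv_itg m k g A x : m.-itg k -> measurable_fun setT g -> (forall x, `|g x| <= A) ->
  m.-itg (fun y : R => g (x - y) * k y).
Proof.
move=> ki mg gA; apply: (itg_bddM _ _ _ A) => //; exact: measurable_reflect.
Qed.

Lemma wconv_bound m k g A x : m.-itg k -> measurable_fun setT g -> (forall x, `|g x| <= A) ->
  `|wconv m k g x| <= A * \int[m]_y `|k y|.
Proof.
move=> ki mg gA; have mk := itg_measurable _ _ ki.
rewrite -RintegralZl//; last exact: itg_norm.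
apply: Rint_norm_le; first by apply: measurable_funM => //; exact: measurable_reflect.
- exact/itgZ/itg_norm.
- by move=> y; rewrite normrM ler_wpM2r.
Qed.

Lemma measurable_wconv m k g : m.-itg k -> measurable_fun setT g -> measurable_fun setT (wconv m k g).
Proof.
move=> ki mg; have mk := itg_measurable _ _ ki.
apply: (measurable_Rint _ (fun z : R * R => g (z.1 - z.2) * k z.2)).
by apply: measurable_funM; [exact: measurable_sub2|exact: measurableT_comp].
Qed.

Lemma wconv_cvg0 m k g A : m.-itg k -> measurable_fun setT g -> (forall x, `|g x| <= A) ->
  g x @[x --> +oo] --> (0 : R) -> wconv m k g x @[x --> +oo] --> (0 : R).
Proof.
move=> ki mg gA g0; have mk := itg_measurable _ _ ki.
have -> : (0 : R) = \int[m]_y (0 : R) by rewrite Rintegral_cst// mul0r.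
apply: (Rint_dct_pinfty _ _ _ (fun y => A * `|k y|)).
- by move=> x; apply: measurable_funM => //; exact: measurable_reflect.
- move=> t; rewrite -[X in _ --> X](mul0r (k t)); apply: cvgMr_tmp.
  exact: cvgy_shift.
- exact/itgZ/itg_norm.
- by near=> x => y; rewrite normrM ler_wpM2r.
Unshelve. all: by end_near.
Qed.

Lemma wconvD m k f g A B x : m.-itg k -> measurable_fun setT f -> (forall x, `|f x| <= A) ->
  measurable_fun setT g -> (forall x, `|g x| <= B) ->
  wconv m k (fun y => f y + g y) x = wconv m k f x + wconv m k g x.
Proof.
move=> ki mf fA mg gB; rewrite /wconv -RintegralD//.
- by apply: eq_Rintegral => y _; rewrite mulrDl.
- exact: (wconv_itg _ _ _ A).
- exact: (wconv_itg _ _ _ B).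
Qed.

Lemma wconvZ m k g A c x : m.-itg k -> measurable_fun setT g -> (forall x, `|g x| <= A) ->
  wconv m k (fun y => c * g y) x = c * wconv m k g x.
Proof.
move=> ki mg gA; rewrite /wconv -RintegralZl//; last exact: (wconv_itg _ _ _ A).
by apply: eq_Rintegral => y _; rewrite mulrA.
Qed.

Lemma wconvB m k f g A B x : m.-itg k -> measurable_fun setT f -> (forall x, `|f x| <= A) ->
  measurable_fun setT g -> (forall x, `|g x| <= B) ->
  wconv m k (fun y => f y - g y) x = wconv m k f x - wconv m k g x.
Proof.
move=> ki mf fA mg gB; rewrite /wconv -RintegralB//.
- by apply: eq_Rintegral => y _; rewrite mulrBl.
- exact: (wconv_itg _ _ _ A).
- exact: (wconv_itg _ _ _ B).
Qed.

Lemma wconv_cst m k c x : m.-itg k -> wconv m k (fun=> c) x = c * \int[m]_y k y.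
Proof. by move=> ki; rewrite /wconv RintegralZl. Qed.

Lemma wconv_comm m n k l g A x : m.-itg k -> n.-itg l -> measurable_fun setT g -> (forall x, `|g x| <= A) ->
  wconv m k (wconv n l g) x = wconv n l (wconv m k g) x.
Proof.
move=> ki li mg gA; have mk := itg_measurable _ _ ki; have ml := itg_measurable _ _ li.
pose F (z : R * R) := g (x - z.1 - z.2) * (k z.1 * l z.2).
have mF : measurable_fun setT F.
  apply: measurable_funM; last by apply: measurable_funM; exact: measurableT_comp.
  by apply: (measurableT_comp mg); do 2 apply: measurable_funB => //.
have Fi : (m \x n)%E.-itg F.
  apply: (itg_bddM _ _ _ A) => //; first exact: itg_prod.
  by apply: (measurableT_comp mg); do 2 apply: measurable_funB => //.
transitivity (\int[m]_y \int[n]_z F (y, z)).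
  apply: eq_Rintegral => y _; rewrite -RintegralZr//; last exact: (wconv_itg _ _ _ A).
  by apply: eq_Rintegral => z _; rewrite /F/=; ring.
rewrite Rint_fubini//.
apply: eq_Rintegral => z _; rewrite -RintegralZr//; last exact: (wconv_itg _ _ _ A).
apply: eq_Rintegral => y _; rewrite /F/= -mulrA; congr (g _ * _); ring.
Qed.

End wconv.

(** * Fejer and de la Vallee-Poussin kernels *)

Section Fejer.
Context {R : realType}.
Implicit Types (s t u v w x y z : R).

Lemma cos_norm_le x : `|cos x| <= 1 :> R.
Proof. by rewrite ler_norml cos_geN1 cos_le1. Qed.

Lemma sin_norm_le x : `|sin x| <= 1 :> R.
Proof. by rewrite ler_norml sin_geN1 sin_le1. Qed.

Lemma measurable_cosM z : measurable_fun setT (fun u : R => cos (z * u)).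
Proof.
apply: (measurableT_comp (f := cos)); last exact: measurable_funM.
by apply: continuous_measurable_fun; exact: continuous_cos.
Qed.

Lemma measurable_sinM z : measurable_fun setT (fun u : R => sin (z * u)).
Proof.
apply: (measurableT_comp (f := sin)); last exact: measurable_funM.
by apply: continuous_measurable_fun; exact: continuous_sin.
Qed.

Lemma cos_lipschitz x y : `|cos x - cos y| <= `|x - y| :> R.
Proof.
wlog xy : x y / x <= y.
  by move=> h; have [|/ltW] := leP x y; [exact: h|rewrite distrC (distrC x); exact: h].
have cc : {within `[x, y], continuous (@cos R)} by apply: continuous_subspaceT; exact: continuous_cos.
have [c _ h] := MVT_segment xy (fun c _ => is_derive_cos c) cc.
by rewrite distrC h normrM normrN (distrC x) ler_piMl// sin_norm_le.
Qed.

Lemma FTC_leb (F f : R -> R) (a b : R) : a < b -> (forall x, is_derive x 1 F (f x)) ->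
  continuous f -> \int[leb]_(x in `[a, b]) f x = F b - F a.
Proof.
move=> ab dF cf; have mf := continuous_measurable_fun cf.
have cF : continuous F.
  by move=> x; apply: differentiable_continuous; apply/derivable1_diffP; apply: ex_derive.
have fi : lebesgue_measure.-integrable `[a, b] (EFin \o f).
  apply: continuous_compact_integrable; first exact: segment_compact.
  exact: continuous_subspaceT.
rewrite Rintegral_leb//; last exact/integrable_leb.
rewrite /Rintegral (@continuous_FTC2 _ f F)//.
- exact: continuous_subspaceT.
- split; first by move=> x _; exact: ex_derive.
  + by apply: cvg_at_right_filter; exact: cF.
  + by apply: cvg_at_left_filter; exact: cF.
- by move=> x _; rewrite derive1E derive_val.
Qed.

(** Only the right half of the usual triangle on [-1, 1], since it is integrated against cosines,
    which are even. *)
Definition triangle z : R := (1 - z) * \1_`[0, 1]%classic z.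

Lemma measurable_triangle : measurable_fun setT triangle.
Proof. by apply: measurable_funM => //; exact: measurable_funB. Qed.

Lemma triangle_ge0 z : 0 <= triangle z.
Proof.
rewrite /triangle indicE; case: (boolP (z \in _)) => [|_]; rewrite ?mulr0//.
by rewrite inE/= in_itv/= mulr1 subr_ge0 => /andP[].
Qed.

Lemma Rint_triangle (f : R -> R) : 
  \int[leb]_z (triangle z * f z) = \int[leb]_(z in `[0, 1]) ((1 - z) * f z).
Proof.
rewrite [RHS]Rintegral_mkcond; apply: eq_Rintegral => z _.
by rewrite /triangle indicE patchE; case: ifP => _; rewrite ?mulr1// mulr0 mul0r.
Qed.

Lemma itg_triangle : leb.-itg triangle.
Proof.
have -> : triangle = (fun z => 1 - z) \_ `[0, 1]%classic.
  by apply/funext => z; rewrite /triangle indicE patchE; case: ifP => _; rewrite ?mulr1// mulr0.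
have mf : measurable_fun setT (fun z : R => 1 - z) by exact: measurable_funB.
rewrite -restrict_EFin; apply/(integrable_mkcond _ _).1 => //.
apply/integrable_leb => //; apply: continuous_compact_integrable; first exact: segment_compact.
by apply: continuous_subspaceT => x; apply: cvgB; [exact: cvg_cst|exact: cvg_id].
Qed.

(* [fejer u = (1 - cos u) / u ^ 2], see [fejer_sqr]; as the Fourier integral of a
   triangle it also has the right value at [0]. *)
Definition fejer u : R := \int[leb]_z (triangle z * cos (u * z)).

Lemma itg_triangle_cos u : leb.-itg (fun z => triangle z * cos (u * z)).
Proof.
have := itg_bddM _ _ _ 1 itg_triangle (measurable_cosM u) (fun z => cos_norm_le _).
by under [X in leb.-integrable _ (EFin \o X)]eq_fun do rewrite mulrC.
Qed.

Lemma Rint_triangle1 : \int[leb]_z triangle z = 2^-1.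
Proof.
under eq_Rintegral do rewrite -[triangle _]mulr1.
rewrite Rint_triangle; under eq_Rintegral do rewrite mulr1.
pose F z : R := z - 2^-1 * z ^+ 2.
have -> : (2^-1 : R) = F 1 - F 0 by rewrite /F; field.
apply: FTC_leb => //.
- move=> x; apply: is_derive_eq.
  by rewrite -[_ *: _]/(_ * _) /GRing.scale/=; field.
- by move=> x; apply: cvgB; [exact: cvg_cst|exact: cvg_id].
Qed.

Lemma fejer_sqr u : u ^+ 2 * fejer u = 1 - cos u.
Proof.
have [->|u0] := eqVneq u 0; first by rewrite expr0n/= mul0r cos0 subrr.
rewrite /fejer Rint_triangle.
pose F z : R := (1 - z) * (u^-1 * sin (u * z)) - u ^- 2 * cos (u * z).
have -> : 1 - cos u = u ^+ 2 * (F 1 - F 0).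
  by rewrite /F subrr mul0r !mulr0 sin0 cos0 !mulr0 !mulr1; field.
congr (_ * _); apply: FTC_leb => //.
- move=> x; apply: is_derive_eq.
  by rewrite /GRing.scale/=; field.
- move=> x; apply: cvgM; first by apply: cvgB; [exact: cvg_cst|exact: cvg_id].
  apply: continuous_comp; last exact: continuous_cos.
  by apply: cvgM; [exact: cvg_cst|exact: cvg_id].
Qed.

Lemma fejer_le u : fejer u <= 2^-1.
Proof.
rewrite -Rint_triangle1; apply: Rint_le; [exact: itg_triangle_cos|exact: itg_triangle|].
by move=> z; rewrite ler_piMr ?triangle_ge0// cos_le1.
Qed.

(** The triangle lives on [0, 1], where [cos (u * z)] is 1-Lipschitz in [u]. This yields continuity
    of [fejer] and its lower bound near 0. *)
Lemma fejer_lipschitz u v : `|fejer u - fejer v| <= `|u - v|.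
Proof.
rewrite /fejer -RintegralB//; [|exact: itg_triangle_cos..].
apply: (@le_trans _ _ (\int[leb]_z (triangle z * `|u - v|))).
  apply: Rint_norm_le.
  - by apply: measurable_funB; apply: measurable_funM => //; do ?[exact: measurable_triangle|exact: measurable_cosM].
  - by have := itgZ _ _ `|u - v| itg_triangle; under eq_fun do rewrite mulrC.
  - move=> z; rewrite -mulrBr normrM ger0_norm ?triangle_ge0//.
    rewrite /triangle indicE; case: (boolP (z \in _)) => [|_]; last by rewrite mulr0 !mul0r.
    rewrite inE/= in_itv/= mulr1 => /andP[z0 z1]; apply: ler_wpM2l; first by rewrite subr_ge0.
    apply: (le_trans (cos_lipschitz _ _)); rewrite -mulrBl normrM ler_piMr//.
    by rewrite ger0_norm.
rewrite RintegralZr//; last exact: itg_triangle.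
by rewrite Rint_triangle1 mulrC ler_piMr// invf_le1// ler1n.
Qed.

Lemma fejer0 : fejer 0 = 2^-1.
Proof. by rewrite -Rint_triangle1; apply: eq_Rintegral => z _; rewrite mul0r cos0 mulr1. Qed.

Lemma fejer_ge0 u : 0 <= fejer u.
Proof.
have [->|u0] := eqVneq u 0; first by rewrite fejer0 invr_ge0.
have u20 : 0 < u ^+ 2 by rewrite exprn_even_gt0.
by rewrite -(pmulr_rge0 _ u20) fejer_sqr subr_ge0 cos_le1.
Qed.

Lemma fejerN u : fejer (- u) = fejer u.
Proof. by apply: eq_Rintegral => z _; rewrite mulNr cosN. Qed.

Lemma continuous_fejer : continuous fejer.
Proof.
move=> x; apply/cvgrPdist_le => e e0; near=> t.
apply: (le_trans (fejer_lipschitz _ _)); near: t.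
by have /cvgrPdist_le := @cvg_id _ (nbhs x); apply.
Unshelve. all: by end_near.
Qed.

Lemma measurable_fejer : measurable_fun setT fejer.
Proof. by apply: continuous_measurable_fun; exact: continuous_fejer. Qed.

(** The 3 rounds up 1/2 + 2, the bounds of [fejer u] and of [1 - cos u]. *)
Lemma fejer_le_inv u : fejer u <= 3 / (1 + u ^+ 2).
Proof.
have h : 0 < 1 + u ^+ 2 by rewrite ltr_pwDl// sqr_ge0.
rewrite ler_pdivlMr// mulrDr mulr1 [fejer u * _]mulrC fejer_sqr.
have := fejer_le u; have := cos_geN1 u; lra.
Qed.

Lemma itg_fejer : leb.-itg fejer.
Proof.
apply: (itg_le _ _ _ measurable_fejer (itgZ _ _ 3 (integrable_invr1Dsqr R))).
by move=> u; rewrite ger0_norm ?fejer_ge0// fejer_le_inv.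
Qed.

(** The number pi, kept abstract as a positive normalising constant. *)
Definition fejer_mass : R := \int[leb]_u fejer u.

Lemma fejer_mass_gt0 : 0 < fejer_mass.
Proof.
(* From the value 1/2 at 0, the Lipschitz constant 1 keeps [fejer] above 1/4 on this interval. *)
pose f u : R := 4^-1 * \1_(`[0, 4^-1]%classic) u.
have mI : measurable (`[0, 4^-1]%classic : set R) by exact: measurable_itv.
have fi : leb.-itg (\1_(`[0, 4^-1]%classic) : R -> R).
  apply/integrable_leb => //.
  exact: integrable_indic_itv.
apply: (@lt_le_trans _ _ (\int[leb]_u f u)).
  rewrite RintegralZl// mulr_gt0// /Rintegral integral_indic// setIT.
  rewrite [X in fine X](_ : _ = 4^-1%:E)//=.
  change (@lebesgue_measure R `[0, 4^-1]%classic = 4^-1%:E).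
  by rewrite lebesgue_measure_itv/= lte_fin invr_gt0 ltr0n/= -EFinD subr0.
apply: Rint_le => [||u].
- exact: itgZ.
- exact: itg_fejer.
- rewrite /f indicE; case: (boolP (u \in _)) => [|_]; last by rewrite mulr0 fejer_ge0.
  rewrite inE/= in_itv/= mulr1 => /andP[u0 u1].
  have := fejer_lipschitz 0 u; rewrite fejer0 ler_norml sub0r normrN ger0_norm//; lra.
Qed.

(** The factor [s ^+ 2] makes the formula valid at [s = 0], which spares [Rint_fejer_cos] a case
    analysis at its three frequencies. *)
Lemma Rint_fejerM s : \int[leb]_u (s ^+ 2 * fejer (s * u)) = `|s| * fejer_mass.
Proof.
have [->|s0] := eqVneq s 0.
  by under eq_Rintegral do rewrite expr0n/= mul0r; rewrite Rintegral_cst// mul0r normr0 mul0r.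
have h := integrable_leb_affine R s 0 fejer s0 itg_fejer.
under eq_Rintegral do rewrite -[s * _]addr0.
rewrite RintegralZl// Rintegral_leb_affine//; last exact: itg_fejer.
rewrite mulrA; congr (_ * _); rewrite -(real_normK (num_real s)) expr2 mulfK//.
by rewrite normr_eq0.
Qed.

Lemma itg_fejer_affine s t : s != 0 -> leb.-itg (fun u => fejer (s * u + t)).
Proof. by move=> s0; exact: (integrable_leb_affine R s t fejer s0 itg_fejer). Qed.

Lemma itg_fejerM s : leb.-itg (fun u => s ^+ 2 * fejer (s * u)).
Proof.
have [->|s0] := eqVneq s 0.
  by under [X in leb.-itg X]eq_fun do rewrite expr0n/= mul0r; exact: integrable0.
apply: itgZ; have := itg_fejer_affine s 0 s0.
by under [X in leb.-itg X]eq_fun do rewrite addr0.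
Qed.

(** The transform is computed without Fourier inversion: product-to-sum formulas write
    [(1 - cos u) * cos (z * u)] as a combination of terms [1 - cos (s * u)] with [s] among [1 + z],
    [1 - z] and [z], and [fejer_sqr] turns each into a dilated [fejer]. The right-hand side is
    [fejer_mass] times the full triangle [max (0, 1 - |z|)]. *)
Lemma Rint_fejer_cos z :
  \int[leb]_u (fejer u * cos (z * u)) = fejer_mass / 2 * (`|1 + z| + `|1 - z| - 2 * `|z|).
Proof.
have E u : fejer u * cos (z * u) = 2^-1 * ((1 + z) ^+ 2 * fejer ((1 + z) * u)
   + (1 - z) ^+ 2 * fejer ((1 - z) * u) - 2 * (z ^+ 2 * fejer (z * u))).
  have [->|u0] := eqVneq u 0; first by rewrite !mulr0 cos0; field.
  have u20 : u ^+ 2 != 0 by rewrite expf_eq0.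
  apply: (mulfI u20); transitivity ((u ^+ 2 * fejer u) * cos (z * u)); first by ring.
  rewrite fejer_sqr.
  have h s : u ^+ 2 * (s ^+ 2 * fejer (s * u)) = 1 - cos (s * u).
    by rewrite -fejer_sqr; ring.
  transitivity (2^-1 * (u ^+ 2 * ((1 + z) ^+ 2 * fejer ((1 + z) * u))
   + u ^+ 2 * ((1 - z) ^+ 2 * fejer ((1 - z) * u)) - 2 * (u ^+ 2 * (z ^+ 2 * fejer (z * u))))); last by ring.
  have e1 : (1 + z) * u = u + z * u by ring.
  have e2 : (1 - z) * u = u - z * u by ring.
  by rewrite !h e1 e2 cosD cosB; field.
under eq_Rintegral do rewrite E.
have ip s := itg_fejerM s; have i2 := itgZ _ _ 2 (itg_fejerM z).
have iD := itgD _ _ _ (ip (1 + z)) (ip (1 - z)).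
rewrite RintegralZl//; last exact: itgB.
rewrite RintegralB// RintegralD// !Rint_fejerM RintegralZl// Rint_fejerM.
by field.
Qed.

(* The Fourier transform of [dlvp] equals 1 on [-1, 1], the band of [fejer]. *)
Definition dlvp u : R := (4 * fejer (2 * u) - fejer u) / fejer_mass.

Lemma measurable_fejerM s : measurable_fun setT (fun u => fejer (s * u)).
Proof. by apply: (measurableT_comp measurable_fejer); exact: measurable_funM. Qed.

Lemma measurable_dlvp : measurable_fun setT dlvp.
Proof.
apply: measurable_funM => //; apply: measurable_funB; last exact: measurable_fejer.
by apply: measurable_funM => //; exact: measurable_fejerM.
Qed.

Lemma dlvpN u : dlvp (- u) = dlvp u.
Proof. by rewrite /dlvp mulrN !fejerN. Qed.

Lemma continuous_dlvp : continuous dlvp.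
Proof.
move=> x; apply: cvgM; last exact: cvg_cst.
apply: cvgB; last exact: continuous_fejer.
apply: cvgM; first exact: cvg_cst.
apply: (@continuous_comp _ _ _ (fun u : R => 2 * u) fejer); last exact: continuous_fejer.
by apply: cvgM; [exact: cvg_cst|exact: cvg_id].
Qed.

Lemma dlvp_bound u : `|dlvp u| <= 15 / fejer_mass * (1 + u ^+ 2)^-1.
Proof.
have c0 := fejer_mass_gt0.
have h : 0 < 1 + u ^+ 2 by rewrite ltr_pwDl// sqr_ge0.
rewrite /dlvp normrM normfV (gtr0_norm c0).
have -> : 15 / fejer_mass * (1 + u ^+ 2)^-1 = (4 * (3 / (1 + u ^+ 2)) + 3 / (1 + u ^+ 2)) / fejer_mass.
  by field; rewrite !gt_eqF.
rewrite ler_pM2r ?invr_gt0//.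
apply: (le_trans (ler_normB _ _)); rewrite ger0_norm ?mulr_ge0 ?fejer_ge0// ger0_norm ?fejer_ge0//.
apply: lerD; last exact: fejer_le_inv.
rewrite ler_pM2l//; apply: (le_trans (fejer_le_inv _)).
rewrite ler_pM2l// lef_pV2 ?posrE//; last by rewrite ltr_pwDl// sqr_ge0.
by rewrite lerD2l exprMn ler_peMl ?sqr_ge0// -natrX ler1n.
Qed.

Lemma itg_dlvp : leb.-itg dlvp.
Proof.
apply: (itg_le _ _ _ measurable_dlvp (itgZ _ _ (15 / fejer_mass) (integrable_invr1Dsqr R))).
exact: dlvp_bound.
Qed.

Lemma itg_dlvp_affine s t : s != 0 -> leb.-itg (fun u => dlvp (s * u + t)).
Proof. by move=> s0; exact: (integrable_leb_affine R s t dlvp s0 itg_dlvp). Qed.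

Lemma itg_dlvp_cos z : leb.-itg (fun v => dlvp v * cos (z * v)).
Proof.
have := itg_bddM _ _ _ 1 itg_dlvp (measurable_cosM z) (fun z => cos_norm_le _).
by under [X in leb.-integrable _ (EFin \o X)]eq_fun do rewrite mulrC.
Qed.

Lemma itg_dlvp_sin z : leb.-itg (fun v => dlvp v * sin (z * v)).
Proof.
have := itg_bddM _ _ _ 1 itg_dlvp (measurable_sinM z) (fun z => sin_norm_le _).
by under [X in leb.-integrable _ (EFin \o X)]eq_fun do rewrite mulrC.
Qed.

Lemma itg_fejer_cos z : leb.-itg (fun v => fejer v * cos (z * v)).
Proof.
have := itg_bddM _ _ _ 1 itg_fejer (measurable_cosM z) (fun z => cos_norm_le _).
by under [X in leb.-integrable _ (EFin \o X)]eq_fun do rewrite mulrC.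
Qed.

(** On this band [4 * fejer (2 * u)] has transform [fejer_mass * (2 - |z|)] and [fejer] has
    [fejer_mass * (1 - |z|)]: the slopes cancel. *)
Lemma Rint_dlvp_cos z : `|z| <= 1 -> \int[leb]_v (dlvp v * cos (z * v)) = 1.
Proof.
move=> z1; have c0 := fejer_mass_gt0.
have two0 : (2 : R) != 0 by [].
have i2 : leb.-itg (fun v => fejer (2 * v) * cos (z / 2 * (2 * v))).
  have := integrable_leb_affine R 2 0 _ two0 (itg_fejer_cos (z / 2)).
  by under [X in leb.-itg X]eq_fun do rewrite addr0.
transitivity (\int[leb]_v (fejer_mass^-1 * (4 * (fejer (2 * v) * cos (z / 2 * (2 * v))) - fejer v * cos (z * v)))).
  apply: eq_Rintegral => v _; rewrite /dlvp (_ : z / 2 * (2 * v) = z * v); [ring|by field].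
rewrite RintegralZl//; last by apply: itgB; [exact: itgZ|exact: itg_fejer_cos].
rewrite RintegralB//; [|exact: itgZ|exact: itg_fejer_cos].
rewrite RintegralZl// Rint_fejer_cos.
have := Rintegral_leb_affine R 2 0 _ two0 (itg_fejer_cos (z / 2)).
under eq_Rintegral do rewrite addr0.
move=> ->; rewrite Rint_fejer_cos.
have [z10 z11] : 0 <= 1 + z /\ 0 <= 1 - z by move: z1; rewrite ler_norml => /andP[]; split; lra.
rewrite (ger0_norm z10) (ger0_norm z11) (ger0_norm (_ : 0 <= 1 + z / 2)); last lra.
rewrite (ger0_norm (_ : 0 <= 1 - z / 2)); last lra.
rewrite normrM normfV (@gtr0_norm _ (2 : R))//; field; exact: lt0r_neq0.
Qed.

Lemma Rint_dlvp_sin z : \int[leb]_v (dlvp v * sin (z * v)) = 0.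
Proof.
have N1 : (-1 : R) != 0 by rewrite oppr_eq0.
have := Rintegral_leb_affine R (-1) 0 _ N1 (itg_dlvp_sin z).
rewrite normrN1 invr1 mul1r; under eq_Rintegral do rewrite addr0 mulN1r dlvpN mulrN sinN mulrN.
under eq_Rintegral do rewrite -mulN1r.
rewrite RintegralZl//; last exact: itg_dlvp_sin.
by move=> h; lra.
Qed.

(** [fejer] is a superposition of cosines of frequencies in [0, 1], and convolution with [dlvp]
    fixes each of them: its cosine transform is 1 there and its sine transform vanishes by
    evenness. *)
Lemma dlvp_conv_fejer w : \int[leb]_v (dlvp v * fejer (w - v)) = fejer w.
Proof.
pose F (p : R * R) := cos ((w - p.1) * p.2) * (dlvp p.1 * triangle p.2).
have Fi : (leb \x leb)%E.-itg F.
  apply: (itg_bddM _ _ _ 1).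
  - exact: itg_prod itg_dlvp itg_triangle.
  - apply: (measurableT_comp (f := cos)).
      by apply: continuous_measurable_fun; exact: continuous_cos.
    by apply: measurable_funM => //; exact: measurable_funB.
  - by move=> p; exact: cos_norm_le.
transitivity (\int[leb]_v \int[leb]_z F (v, z)).
  apply: eq_Rintegral => v _; rewrite /fejer -RintegralZl//; last exact: itg_triangle_cos.
  by apply: eq_Rintegral => z _; rewrite /F/=; ring.
rewrite Rint_fubini//; apply: eq_Rintegral => z _.
transitivity (\int[leb]_v (triangle z * cos (w * z) * (dlvp v * cos (z * v)) + triangle z * sin (w * z) * (dlvp v * sin (z * v)))).
  by apply: eq_Rintegral => v _; rewrite /F/= mulrBl cosB [v * z]mulrC; ring.
rewrite RintegralD//; last 2 first.
- exact/itgZ/itg_dlvp_cos.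
- exact/itgZ/itg_dlvp_sin.
rewrite !RintegralZl//; [|exact: itg_dlvp_sin|exact: itg_dlvp_cos].
rewrite Rint_dlvp_sin mulr0 addr0 /triangle indicE; case: (boolP (z \in _)) => [|_]; last by rewrite mulr0 !mul0r.
rewrite inE/= in_itv/= => /andP[z0 z1]; rewrite Rint_dlvp_cos ?mulr1// ger0_norm//.
Qed.

End Fejer.

(** * L1 modulus of continuity and functions reproduced by a kernel *)

Section modulus.
Context {R : realType}.
Implicit Types (p q v k : R -> R) (kap : {sigma_finite_measure set R -> \bar R}).

Definition l1mod v (y : R) := \int[leb]_w `|v (w - y) - v w|.

Lemma itg_shift v (y : R) : leb.-itg v -> leb.-itg (fun w => v (w - y)).
Proof.
move=> vi; have := integrable_leb_affine R 1 (- y) v (oner_neq0 _) vi.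
by under [X in leb.-itg X]eq_fun do rewrite mul1r.
Qed.

Lemma Rint_shift v (y : R) : leb.-itg v -> \int[leb]_w v (w - y) = \int[leb]_w v w.
Proof.
move=> vi; have := Rintegral_leb_affine R 1 (- y) v (oner_neq0 _) vi.
by under eq_Rintegral do rewrite mul1r; rewrite normr1 invr1 mul1r.
Qed.

Lemma itg_diff v (y : R) : leb.-itg v -> leb.-itg (fun w => `|v (w - y) - v w|).
Proof. by move=> vi; apply/itg_norm/itgB => //; exact: itg_shift. Qed.

Lemma l1mod_ge0 v y : 0 <= l1mod v y.
Proof. exact: Rintegral_ge0. Qed.

Lemma l1mod_le v y : leb.-itg v -> l1mod v y <= 2 * \int[leb]_w `|v w|.
Proof.
move=> vi; have vn := itg_norm _ _ vi; have vs := itg_shift _ y vn.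
apply: (@le_trans _ _ (\int[leb]_w (`|v (w - y)| + `|v w|))).
  apply: Rint_le => [||w]; [exact: itg_diff|exact: itgD|exact: ler_normB].
by rewrite RintegralD// (Rint_shift (fun w => `|v w|))// mulr_natl.
Qed.

Lemma itg_prod_shift kap q v : kap.-itg q -> leb.-itg v ->
  (kap \x leb)%E.-itg (fun z => v (z.2 - z.1) * q z.1).
Proof.
move=> qi vi; have mq := itg_measurable _ _ qi; have mv := itg_measurable _ _ vi.
have mF : measurable_fun setT (fun z : R * R => v (z.2 - z.1) * q z.1).
  apply: measurable_funM; last exact: measurableT_comp.
  by apply: (measurableT_comp mv); exact: measurable_funB.
apply/integrable12ltyP; first exact/measurable_EFinP.
under eq_integral => y _.
  under eq_integral => w _ do rewrite /= normrM EFinM.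
  rewrite ge0_integralZr//; last first.
    apply/measurable_EFinP; apply: measurableT_comp => //; apply: (measurableT_comp mv).
    exact: measurable_funB.
  rewrite (_ : (\int[leb]_w _ = \int[leb]_w `|v w|%:E)%E); last first.
    have := @ge0_integral_leb_affine R 1 (- y) (fun w => `|v w|%:E) (oner_neq0 _).
    rewrite normr1 invr1 mul1e; under eq_integral do rewrite mul1r.
    by apply => //; apply/measurable_EFinP; exact: measurableT_comp.
  over.
rewrite ge0_integralZl//.
- by rewrite lte_mul_pinfty ?integral_ge0//; [apply/integrable_fin_num => //; exact: itg_norm|
   have /integrableP[_] := qi].
- by apply/measurable_EFinP; apply: measurableT_comp.
- by rewrite integral_ge0.
Qed.

Lemma itg_l1mod kap q v : kap.-itg q -> leb.-itg v ->
  (kap \x leb)%E.-itg (fun z => `|v (z.2 - z.1) - v z.2| * `|q z.1|).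
Proof.
move=> qi vi; have h1 := itg_prod_shift _ _ _ qi vi; have h2 := itg_prod _ _ _ _ qi vi.
have := itg_norm _ _ (itgB _ _ _ h1 h2).
apply: eq_integrable => // z _ /=; congr (_ %:E).
by rewrite -normrM; congr `|_|; ring.
Qed.

Lemma itg_l1mod1 kap q v : kap.-itg q -> leb.-itg v -> kap.-itg (fun y => l1mod v y * `|q y|).
Proof.
move=> qi vi; have := itg_Rint _ _ _ (itg_l1mod _ _ _ qi vi).
apply: eq_integrable => // y _ /=; congr (_ %:E).
by rewrite RintegralZr//; exact: itg_diff.
Qed.

Lemma measurable_l1mod v : measurable_fun setT v -> measurable_fun setT (l1mod v).
Proof.
move=> mv; apply: (measurable_Rint _ (fun z : R * R => `|v (z.2 - z.1) - v z.2|)).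
apply: measurableT_comp => //; apply: measurable_funB; last exact: measurableT_comp.
by apply: (measurableT_comp mv); exact: measurable_funB.
Qed.

(* Since [a = v * a], the increment [a (u - y) - a u] is an integral of [a] against
   [v (. - y) - v], whose L1 norm is [l1mod v y]. *)
Lemma wconv_reproduced kap q v (a : R -> R) (A B C e : R) : kap.-itg q -> leb.-itg v -> (forall x, `|v x| <= C) ->
  measurable_fun setT a -> (forall u, `|a u| <= A) -> (forall u, wconv leb v a u = a u) ->
  0 <= B -> (exists X, forall u, X < u -> `|a u| <= B) -> 0 < e ->
  exists X, forall u, X < u ->
    `|wconv kap q a u - a u * \int[kap]_y q y| <= B * \int[kap]_y (l1mod v y * `|q y|) + e.
Proof.
move=> qi vi vC ma aA av B0 [X0 aB] e0.
have mq := itg_measurable _ _ qi; have mv := itg_measurable _ _ vi.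
pose H (z : R * R) : R := `|v (z.2 - z.1) - v z.2| * `|q z.1|.
have Hi : (kap \x leb)%E.-itg H := itg_l1mod _ _ _ qi vi.
pose K w := \int[kap]_y H (y, w).
have Ki : leb.-itg K := itg_Rint _ _ _ (itg_swap _ _ _ Hi).
(* The bound [B] holds only for large arguments. The excess of [|a|] over [B] is bounded and tends
   to 0, hence so does its convolution with the integrable [K]; this is what [e] pays for. *)
pose b u : R := Num.max (`|a u| - B) 0.
have b0 u : 0 <= b u by rewrite /b le_max lexx orbT.
have mb : measurable_fun setT b.
  by apply: measurable_maxr => //; apply: measurable_funB => //; exact: measurableT_comp.
have A0 : 0 <= A by apply: le_trans (aA 0).
have bA u : `|b u| <= A.
  by rewrite ger0_norm// /b ge_max A0 andbT lerBlDr ler_wpDr.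
have ab u : `|a u| <= B + b u.
  by rewrite -lerBlDl /b le_max lexx.
have bc : b x @[x --> +oo] --> (0 : R).
  apply/cvgyP => d d0; exists X0 => u uX; rewrite subr0 ger0_norm// /b ge_max (ltW d0) andbT.
  by rewrite lerBlDr (le_trans (aB u uX))// ler_wpDl// ltW.
have /cvgyP/(_ e e0)[X hX] := wconv_cvg0 _ _ _ _ Ki mb bA bc.
exists X => u /hX; rewrite subr0 => /(le_trans (ler_norm _)) hK.
have ai (y : R) : leb.-itg (fun w => a (u - w) * v (w - y)).
  exact: (wconv_itg _ _ _ A _ (itg_shift _ y vi) ma aA).
have ai0 : leb.-itg (fun w => a (u - w) * v w).
  exact: (wconv_itg _ _ _ A _ vi ma aA).
have key y : a (u - y) - a u = \int[leb]_w (a (u - w) * (v (w - y) - v w)).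
  under eq_Rintegral do rewrite mulrBr.
  rewrite RintegralB//; congr (_ - _); last by rewrite -[LHS]av.
  rewrite -[LHS]av /wconv -(Rint_shift (fun w => a (u - y - w) * v w) y).
    by apply: eq_Rintegral => w _; congr (a _ * _); ring.
  exact: (wconv_itg _ _ _ A _ vi ma aA).
have iq := wconv_itg _ _ _ A u qi ma aA.
have -> : wconv kap q a u - a u * \int[kap]_y q y = \int[kap]_y ((a (u - y) - a u) * q y).
  rewrite -RintegralZl// /wconv -RintegralB//; last exact: itgZ.
  by apply: eq_Rintegral => y _; rewrite mulrBl.
have Gi : (kap \x leb)%E.-itg (fun z : R * R => b (u - z.2) * H z).
  apply: (itg_bddM _ _ _ A) => //.
  by apply: (measurableT_comp mb); exact: measurable_funB.
have HBi : (kap \x leb)%E.-itg (fun z : R * R => B * H z + b (u - z.2) * H z).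
  by apply: itgD => //; exact: itgZ.
apply: (@le_trans _ _ (\int[kap]_y \int[leb]_w (B * H (y, w) + b (u - w) * H (y, w)))).
  apply: Rint_norm_le.
  - apply: measurable_funM => //; apply: measurable_funB => //; exact: measurable_reflect.
  - exact: (itg_Rint _ _ _ HBi).
  - move=> y; rewrite key normrM.
    have bi : leb.-itg (fun w => b (u - w) * `|v (w - y) - v w|).
      exact: (wconv_itg _ _ _ A _ (itg_diff v y vi) mb bA).
    have Bi : leb.-itg (fun w => (B + b (u - w)) * `|v (w - y) - v w|).
      have := itgD _ _ _ (itgZ _ _ B (itg_diff v y vi)) bi.
      by apply: eq_integrable => // w _ /=; rewrite mulrDl.
    apply: (@le_trans _ _ ((\int[leb]_w ((B + b (u - w)) * `|v (w - y) - v w|)) * `|q y|)).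
      apply: ler_wpM2r => //; apply: Rint_norm_le => //.
        apply: measurable_funM; first exact: measurable_reflect.
        by apply: measurable_funB => //; apply: (measurableT_comp mv); exact: measurable_funB.
      by move=> w; rewrite normrM ler_wpM2r.
    rewrite -RintegralZr// le_eqVlt; apply/orP; left; apply/eqP.
    by apply: eq_Rintegral => w _; rewrite /H/=; ring.
rewrite (Rint_Rint _ _ (fun z : R * R => B * H z + b (u - z.2) * H z))// RintegralD//; last exact: itgZ.
rewrite RintegralZl// -(Rint_Rint _ _ H)// -(Rint_Rint _ _ (fun z : R * R => b (u - z.2) * H z))// lerD//.
  rewrite ler_wpM2l// le_eqVlt; apply/orP; left; apply/eqP.
  by apply: eq_Rintegral => y _; rewrite -RintegralZr//; exact: itg_diff.
apply: le_trans hK; rewrite (Rint_fubini _ _ (fun z : R * R => b (u - z.2) * H z))//.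
rewrite le_eqVlt; apply/orP; left; apply/eqP.
apply: eq_Rintegral => w _.
transitivity (\int[kap]_y (b (u - w) * H (y, w))); first by [].
rewrite RintegralZl//.
have mvw : measurable_fun setT (fun y : R => v (w - y) - v w).
  by apply: measurable_funB => //; exact: measurable_reflect.
apply: (itg_bddM kap (fun y => `|v (w - y) - v w|) (fun y => `|q y|) (C + C)).
- exact: itg_norm.
- exact: measurableT_comp.
- by move=> y; rewrite normr_id (le_trans (ler_normB _ _))// lerD.
Qed.

Lemma cvg_divy0 (y : R) : y / x @[x --> +oo] --> (0 : R).
Proof.
apply/cvgyP => e e0; exists (Num.max 1 (`|y| / e)) => x; rewrite gt_max => /andP[x1 xe].
have x0 : 0 < x by apply: lt_trans x1.
by rewrite subr0 normrM normfV (gtr0_norm x0) ler_pdivrMr// mulrC -ler_pdivrMr// ltW.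
Qed.

Lemma l1mod_dlvp_cvg0 (y : R) : l1mod dlvp (y / x) @[x --> +oo] --> (0 : R).
Proof.
have -> : (0 : R) = \int[leb]_w `|dlvp w - dlvp w|.
  by under eq_Rintegral do rewrite subrr normr0; rewrite Rintegral_cst// mul0r.
have c0 := @fejer_mass_gt0 R.
(* 75 = 60 + 15. For [|t| <= 1] one has [1 + w ^+ 2 <= 4 * (1 + (w - t) ^+ 2)], so the shifted
   kernel obeys [dlvp_bound] with 15 replaced by 60. *)
pose D (w : R) := 75 / fejer_mass * (1 + w ^+ 2)^-1.
have h (w : R) : 0 < 1 + w ^+ 2 by rewrite ltr_pwDl// sqr_ge0.
have mv := @measurable_dlvp R.
apply: (Rint_dct_pinfty _ _ (fun w => `|dlvp w - dlvp w|) D).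
- move=> x; apply: measurableT_comp => //; apply: measurable_funB => //.
  by apply: (measurableT_comp mv); exact: measurable_funB.
- move=> w; apply: cvg_norm; apply: cvgB; last exact: cvg_cst.
  apply: (cvg_comp (fun x => w - y / x) dlvp (G := nbhs w)); last exact: continuous_dlvp.
  suff: w - y / x @[x --> +oo] --> w - 0 by rewrite subr0.
  by apply: cvgB; [exact: cvg_cst|exact: cvg_divy0].
- exact/itgZ/integrable_invr1Dsqr.
- exists (Num.max 1 `|y|); split; first exact: num_real.
  move=> x; rewrite gt_max => /andP[x1 xy] w.
  have x0 : 0 < x by apply: lt_trans x1.
  set t := y / x; have t1 : `|t| <= 1.
    by rewrite /t normrM normfV (gtr0_norm x0) ler_pdivrMr// mul1r ltW.
  have t2 : t ^+ 2 <= 1 by rewrite -(real_normK (num_real t)) expr_le1.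
  rewrite normr_id; apply: (le_trans (ler_normB _ _)).
  have -> : D w = 60 / fejer_mass * (1 + w ^+ 2)^-1 + 15 / fejer_mass * (1 + w ^+ 2)^-1.
    by rewrite /D; field; rewrite !gt_eqF.
  apply: lerD; last exact: dlvp_bound.
  apply: (le_trans (dlvp_bound _)).
  have -> : 60 / @fejer_mass R = 15 / fejer_mass * 4 by field; rewrite gt_eqF.
  rewrite -(mulrA (15 / fejer_mass)) ler_pM2l ?divr_gt0// ler_pdivlMr// mulrC ler_pdivrMr//.
  have := sqr_ge0 (w - 2 * t); nra.
Qed.

(** The gain from a narrow band: on the scale [x] of the kernel, the displacements [y] carrying most
    of [q] become negligible. *)
Lemma eta_cvg0 kap q : kap.-itg q ->
  \int[kap]_y (l1mod dlvp (y / x) * `|q y|) @[x --> +oo] --> (0 : R).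
Proof.
move=> qi; have mq := itg_measurable _ _ qi; have vi := @itg_dlvp R.
have -> : (0 : R) = \int[kap]_w (0 : R) by rewrite Rintegral_cst// mul0r.
apply: (Rint_dct_pinfty _ _ _ (fun y => 2 * (\int[leb]_w `|dlvp w|) * `|q y|)).
- move=> x; apply: measurable_funM; last exact: measurableT_comp.
  by apply: (measurableT_comp (measurable_l1mod _ measurable_dlvp)); exact: measurable_funM.
- move=> y; rewrite -[X in _ --> X](mul0r `|q y|); apply: cvgMr_tmp; exact: l1mod_dlvp_cvg0.
- exact/itgZ/itg_norm.
- near=> x => y; rewrite normrM normr_id ler_wpM2r// ger0_norm ?l1mod_ge0//; exact: l1mod_le.
Unshelve. all: by end_near.
Qed.
End modulus.

(** * Dilated kernels and the reproducing identity *)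

Section reproducing.
Context {R : realType}.
Implicit Types (G : R -> R) (x u w y z : R).

(** Left unnormalised, because it also serves as a factor of the product kernel, where it must stay
    bounded below near 0 uniformly in [x]. Its companion [dlvp_dil] has to reproduce, so it keeps
    total mass 1. *)
Definition fejer_dil x w : R := fejer (w / x).
Definition dlvp_dil x w : R := x^-1 * dlvp (w / x).

Lemma itg_fejer_dil x : x != 0 -> leb.-itg (fejer_dil x).
Proof.
move=> x0; have := itg_fejer_affine x^-1 0 (invr_neq0 x0).
by apply: eq_integrable => // w _ /=; rewrite /fejer_dil addr0 mulrC.
Qed.

Lemma itg_dlvp_dil x : x != 0 -> leb.-itg (dlvp_dil x).
Proof.
move=> x0; apply: itgZ; have := itg_dlvp_affine x^-1 0 (invr_neq0 x0).
by apply: eq_integrable => // w _ /=; rewrite addr0 mulrC.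
Qed.

Lemma measurable_fejer_dil x : measurable_fun setT (fejer_dil x).
Proof. by apply: (measurableT_comp measurable_fejer); exact: measurable_funM. Qed.

Lemma dlvp_dil_bound x w : 0 < x -> `|dlvp_dil x w| <= x^-1 * (15 / fejer_mass).
Proof.
move=> x0; have xV : 0 < x^-1 by rewrite invr_gt0.
rewrite /dlvp_dil normrM (gtr0_norm xV) ler_pM2l//.
apply: (le_trans (dlvp_bound _)); rewrite ler_piMr//.
  by rewrite divr_ge0// ltW// fejer_mass_gt0.
by rewrite invf_le1 ?ler_wpDr ?sqr_ge0// ltr_pwDl// sqr_ge0.
Qed.

(** The L1 norm is unchanged by the normalised dilation, so widening the kernel amounts to shrinking
    the displacement. *)
Lemma l1mod_dlvp_dil x y : 0 < x -> l1mod (dlvp_dil x) y = l1mod dlvp (y / x).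
Proof.
move=> x0; have xV0 : x^-1 != 0 by rewrite invr_neq0// gt_eqF.
have := Rintegral_leb_affine R x^-1 0 _ xV0 (itg_diff dlvp (y / x) itg_dlvp).
rewrite gtr0_norm ?invr_gt0// => h.
have di : leb.-itg (fun w => `|dlvp (x^-1 * w + 0 - y / x) - dlvp (x^-1 * w + 0)|).
  exact: (integrable_leb_affine R x^-1 0 _ xV0 (itg_diff dlvp (y / x) itg_dlvp)).
transitivity (x^-1 * \int[leb]_w `|dlvp (x^-1 * w + 0 - y / x) - dlvp (x^-1 * w + 0)|).
  rewrite -RintegralZl//; apply: eq_Rintegral => w _.
  rewrite /dlvp_dil -mulrBr normrM (@gtr0_norm _ x^-1) ?invr_gt0//.
  by congr (_ * `|dlvp _ - dlvp _|); ring.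
by rewrite h invrK mulrA mulVf ?gt_eqF// mul1r.
Qed.

Lemma dlvp_dil_conv_fejer_dil x w : 0 < x -> \int[leb]_y (fejer_dil x (w - y) * dlvp_dil x y) = fejer_dil x w.
Proof.
move=> x0; have xV0 : x^-1 != 0 by rewrite invr_neq0// gt_eqF.
have mh : measurable_fun setT (fun y : R => fejer (w / x - y)).
  by apply: (measurableT_comp measurable_fejer); exact: measurable_funB.
have hi : leb.-itg (fun y => dlvp y * fejer (w / x - y)).
  have := itg_bddM leb (fun y => fejer (w / x - y)) dlvp 2^-1 itg_dlvp mh.
  rewrite (_ : (fun y => dlvp y * fejer (w / x - y)) = (fun y => fejer (w / x - y) * dlvp y)).
    by apply => y; rewrite ger0_norm ?fejer_le ?fejer_ge0.
  by apply/funext => y; rewrite mulrC.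
have h := Rintegral_leb_affine R x^-1 0 _ xV0 hi.
have di := integrable_leb_affine R x^-1 0 _ xV0 hi.
rewrite /fejer_dil -(dlvp_conv_fejer (w / x)).
transitivity (x^-1 * \int[leb]_y (dlvp (x^-1 * y + 0) * fejer (w / x - (x^-1 * y + 0)))).
  rewrite -RintegralZl//; apply: eq_Rintegral => y _.
  by rewrite /dlvp_dil addr0 mulrBl (mulrC x^-1 y); ring.
by rewrite h gtr0_norm ?invr_gt0// invrK mulrA mulVf ?gt_eqF// mul1r.
Qed.

(** Associativity reduces this to the reproduction of [fejer_dil x] itself, so any bounded [G] is
    allowed; it is applied to the two demodulations of [g]. *)
Lemma wconv_dlvp_dil_fejer_dil x G A u : 0 < x -> measurable_fun setT G -> (forall t, `|G t| <= A) ->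
  wconv leb (dlvp_dil x) (wconv leb (fejer_dil x) G) u = wconv leb (fejer_dil x) G u.
Proof.
move=> x0 mG GA; have xn0 : x != 0 by rewrite gt_eqF.
have fejer_ := itg_fejer_dil x xn0; have vpi := itg_dlvp_dil x xn0.
pose F (z : R * R) : R := G (u - z.2) * (fejer_dil x (z.2 - z.1) * dlvp_dil x z.1).
have Fi : (leb \x leb)%E.-itg F.
  apply: (itg_bddM _ _ _ A).
  - exact: (itg_prod_shift leb (dlvp_dil x) (fejer_dil x)).
  - by apply: (measurableT_comp mG); exact: measurable_funB.
  - by [].
transitivity (\int[leb]_y \int[leb]_w F (y, w)).
  apply: eq_Rintegral => y _.
  have ii := wconv_itg _ _ _ A (u - y) fejer_ mG GA.
  rewrite /wconv -RintegralZr// -(Rint_shift (fun w => G (u - y - w) * fejer_dil x w * dlvp_dil x y) y).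
    by apply: eq_Rintegral => w _; rewrite /F/= mulrA; congr (G _ * _ * _); ring.
  have := itgZ _ _ (dlvp_dil x y) ii.
  by apply: eq_integrable => // w _ /=; rewrite mulrC.
rewrite Rint_fubini//; apply: eq_Rintegral => w _.
rewrite /F/= RintegralZl//; first by rewrite dlvp_dil_conv_fejer_dil.
apply: (wconv_itg _ _ _ 2^-1 w vpi (measurable_fejer_dil x)).
by move=> t; rewrite ger0_norm ?fejer_le ?fejer_ge0.
Qed.

End reproducing.

(** * The Wiener-Pitt theorem *)

Section Wiener.
Context {R : realType}.
Variables (kap : {sigma_finite_measure set R -> \bar R}) (p g : R -> R) (A : R).
Hypotheses (ip : kap.-itg p) (mg : measurable_fun setT g) (gA : forall x, `|g x| <= A).
Hypothesis gp0 : wconv kap p g x @[x --> +oo] --> (0 : R).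
Implicit Types (x u w y z : R).

Let pcos z y : R := cos (z * y) * p y.
Let psin z y : R := sin (z * y) * p y.
Let gcos z u : R := g u * cos (z * u).
Let gsin z u : R := g u * sin (z * u).
Let ga x z := wconv leb (fejer_dil x) (gcos z).
Let gb x z := wconv leb (fejer_dil x) (gsin z).

Let A0 : 0 <= A. Proof. exact: le_trans (gA 0). Qed.

Let ipcos z : kap.-itg (pcos z).
Proof. exact: itg_bddM ip (measurable_cosM z) (fun=> cos_norm_le _). Qed.

Let ipsin z : kap.-itg (psin z).
Proof. exact: itg_bddM ip (measurable_sinM z) (fun=> sin_norm_le _). Qed.

Let mgcos z : measurable_fun setT (gcos z).
Proof. by apply: measurable_funM => //; exact: measurable_cosM. Qed.

Let mgsin z : measurable_fun setT (gsin z).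
Proof. by apply: measurable_funM => //; exact: measurable_sinM. Qed.

Let gcosA z u : `|gcos z u| <= A.
Proof. by rewrite normrM -[A]mulr1 ler_pM// cos_norm_le. Qed.

Let gsinA z u : `|gsin z u| <= A.
Proof. by rewrite normrM -[A]mulr1 ler_pM// sin_norm_le. Qed.

Let N1 := A * \int[kap]_y `|p y|.

Let wcA u : `|wconv kap p g u| <= N1.
Proof. exact: wconv_bound. Qed.

Let bounded_cvg0 (k h : R -> R) : measurable_fun setT h -> (forall u, `|h u| <= 1) -> leb.-itg k ->
  wconv leb k (fun t => h t * wconv kap p g t) u @[u --> +oo] --> (0 : R).
Proof.
move=> mh h1 ki; apply: (wconv_cvg0 _ _ _ N1) => //.
- by apply: measurable_funM => //; exact: measurable_wconv.
- by move=> u; rewrite normrM -[N1]mul1r ler_pM.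
- apply/cvgyP => e e0; have /cvgyP/(_ e e0)[X hX] := gp0.
  exists X => u /hX; rewrite !subr0 normrM; apply: le_trans.
  by rewrite ler_piMl.
Qed.

(** By the addition formula for [z * t = z * (t - y) + z * y], [cos (z * t)] times the convolution
    of [g] with [p] is the real part of the demodulated [g] convolved with the modulated [p].
    Smoothing by [fejer_dil x] commutes with this, and the left factor is at most 1, so the limit 0
    persists. *)
Let rotation_cos x z : x != 0 ->
  wconv kap (pcos z) (ga x z) u - wconv kap (psin z) (gb x z) u @[u --> +oo] --> (0 : R).
Proof.
move=> x0; have ph := itg_fejer_dil x x0.
have := bounded_cvg0 _ _ (measurable_cosM z) (fun=> cos_norm_le _) ph.
apply: cvg_trans; rewrite (@eq_cvg _ _ _ _ (wconv leb (fejer_dil x) (fun t => cos (z * t) * wconv kap p g t)))// => u.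
rewrite (wconv_comm _ _ _ _ _ A u (ipcos z) ph)// (wconv_comm _ _ _ _ _ A u (ipsin z) ph)//.
rewrite -(wconvB _ _ _ _ (A * \int[kap]_y `|pcos z y|) (A * \int[kap]_y `|psin z y|))//.
- congr (wconv _ _ _ _); apply/funext => t; rewrite /wconv -RintegralZl//; last exact: (wconv_itg _ _ _ A).
  rewrite -RintegralB//; [|exact: (wconv_itg _ _ _ A)..].
  apply: eq_Rintegral => y _; rewrite /gcos /gsin /pcos /psin.
  have -> : z * t = z * (t - y) + z * y by ring.
  by rewrite cosD; ring.
- exact: measurable_wconv.
- by move=> t; exact: wconv_bound.
- exact: measurable_wconv.
- by move=> t; exact: wconv_bound.
Qed.

Let rotation_sin x z : x != 0 ->
  wconv kap (psin z) (ga x z) u + wconv kap (pcos z) (gb x z) u @[u --> +oo] --> (0 : R).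
Proof.
move=> x0; have ph := itg_fejer_dil x x0.
have := bounded_cvg0 _ _ (measurable_sinM z) (fun=> sin_norm_le _) ph.
apply: cvg_trans; rewrite (@eq_cvg _ _ _ _ (wconv leb (fejer_dil x) (fun t => sin (z * t) * wconv kap p g t)))// => u.
rewrite (wconv_comm _ _ _ _ _ A u (ipsin z) ph)// (wconv_comm _ _ _ _ _ A u (ipcos z) ph)//.
rewrite -(wconvD _ _ _ _ (A * \int[kap]_y `|psin z y|) (A * \int[kap]_y `|pcos z y|))//.
- congr (wconv _ _ _ _); apply/funext => t; rewrite /wconv -RintegralZl//; last exact: (wconv_itg _ _ _ A).
  rewrite -RintegralD//; [|exact: (wconv_itg _ _ _ A)..].
  apply: eq_Rintegral => y _; rewrite /gcos /gsin /pcos /psin.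
  have -> : z * t = z * (t - y) + z * y by ring.
  by rewrite sinD; ring.
- exact: measurable_wconv.
- by move=> t; exact: wconv_bound.
- exact: measurable_wconv.
- by move=> t; exact: wconv_bound.
Qed.

Let C z := \int[kap]_y pcos z y.
Let S z := \int[kap]_y psin z y.
Let P := \int[kap]_y `|p y|.

Let CP z : `|C z| <= P.
Proof.
apply: Rint_norm_le; [exact: itg_measurable (ipcos z)|exact: itg_norm|].
by move=> y; rewrite normrM ler_piMl// cos_norm_le.
Qed.

Let SP z : `|S z| <= P.
Proof.
apply: Rint_norm_le; [exact: itg_measurable (ipsin z)|exact: itg_norm|].
by move=> y; rewrite normrM ler_piMl// sin_norm_le.
Qed.

Let eta x := \int[kap]_y (l1mod dlvp (y / x) * `|p y|).

Let eta_le x q : 0 < x -> kap.-itg q -> (forall y, `|q y| <= `|p y|) ->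
  \int[kap]_y (l1mod (dlvp_dil x) y * `|q y|) <= eta x.
Proof.
move=> x0 qi qp; have vi := itg_dlvp_dil x (lt0r_neq0 x0).
apply: (@le_trans _ _ (\int[kap]_y (l1mod (dlvp_dil x) y * `|p y|))).
  apply: Rint_le; [exact: itg_l1mod1|exact: itg_l1mod1|].
  by move=> y; rewrite ler_wpM2l// l1mod_ge0.
by rewrite le_eqVlt; apply/orP; left; apply/eqP; apply: eq_Rintegral => y _; rewrite l1mod_dlvp_dil.
Qed.

(* Up to errors of order [B * eta x], [(a C - b S, a S + b C)] tends to 0; it is the
   image of [(a, b)] under a similarity of squared ratio [C ^ 2 + S ^ 2 >= K0]. *)
Let contraction x z B K0 : 0 < x -> 0 < B -> 0 < K0 -> K0 <= C z ^+ 2 + S z ^+ 2 ->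
  16 * P * eta x <= K0 ->
  (exists X, forall u, X < u -> `|ga x z u| <= B /\ `|gb x z u| <= B) ->
  (exists X, forall u, X < u -> `|ga x z u| <= B / 2 /\ `|gb x z u| <= B / 2).
Proof.
move=> x0 B0 K00 K0le etaK [X hX].
have xn0 := lt0r_neq0 x0; have ph := itg_fejer_dil x xn0; have vi := itg_dlvp_dil x xn0.
have P0 : 0 <= P by exact: Rintegral_ge0.
(* The target [2 * P * D <= K0 * (B / 2)] is shared equally: [4 * P * B * eta x] is at most a
   quarter of [K0 * B] by hypothesis, and [6 * P * e] by this choice. [P + 1] avoids division by
   0. *)
pose e := K0 * B / (24 * (P + 1)).
have P1 : 0 < P + 1 by rewrite ltr_wpDl.
have e0 : 0 < e by rewrite divr_gt0 ?mulr_gt0.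
have ePK : 24 * (P * e) <= K0 * B.
  have -> : K0 * B = 24 * ((P + 1) * e) by rewrite /e; field; rewrite gt_eqF.
  by rewrite ler_pM2l// ler_pM2r// lerDl.
have rep (q G : R -> R) : kap.-itg q -> (forall y, `|q y| <= `|p y|) -> measurable_fun setT G ->
    (forall u, `|G u| <= A) -> (forall u, X < u -> `|wconv leb (fejer_dil x) G u| <= B) ->
    exists X, forall u, X < u ->
    `|wconv kap q (wconv leb (fejer_dil x) G) u - wconv leb (fejer_dil x) G u * \int[kap]_y q y| <= B * eta x + e.
  move=> qi qp mG GA GB.
  have [Y hY] := wconv_reproduced kap q (dlvp_dil x) (wconv leb (fejer_dil x) G) (A * \int[leb]_y `|fejer_dil x y|) B
    (x^-1 * (15 / fejer_mass)) e qi vi (fun w => dlvp_dil_bound x w x0) (measurable_wconv _ _ _ ph mG)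
    (fun u => wconv_bound _ _ _ _ u ph mG GA) (fun u => wconv_dlvp_dil_fejer_dil x G A u x0 mG GA) (ltW B0)
    (ex_intro _ X GB) e0.
  exists Y => u /hY /le_trans; apply; rewrite lerD2r ler_pM2l//; exact: eta_le.
have pc y : `|pcos z y| <= `|p y| by rewrite normrM ler_piMl// cos_norm_le.
have ps y : `|psin z y| <= `|p y| by rewrite normrM ler_piMl// sin_norm_le.
have [Y1 h1] := rep _ _ (ipcos z) pc (mgcos z) (gcosA z) (fun u uX => (hX u uX).1).
have [Y2 h2] := rep _ _ (ipsin z) ps (mgcos z) (gcosA z) (fun u uX => (hX u uX).1).
have [Y3 h3] := rep _ _ (ipcos z) pc (mgsin z) (gsinA z) (fun u uX => (hX u uX).2).
have [Y4 h4] := rep _ _ (ipsin z) ps (mgsin z) (gsinA z) (fun u uX => (hX u uX).2).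
have /cvgyP/(_ e e0)[Y5 h5] := rotation_cos x z xn0.
have /cvgyP/(_ e e0)[Y6 h6] := rotation_sin x z xn0.
exists (Num.max (Num.max Y1 Y2) (Num.max (Num.max Y3 Y4) (Num.max Y5 Y6))) => u.
rewrite !gt_max => /andP[/andP[/h1 {}h1 /h2 {}h2] /andP[/andP[/h3 {}h3 /h4 {}h4] /andP[/h5 {}h5 /h6 {}h6]]].
rewrite -/(ga x z) -/(gb x z) -/(C z) -/(S z) in h1 h2 h3 h4.
set a := ga x z u in h1 h2 *; set b := gb x z u in h3 h4 *.
rewrite !subr0 in h5 h6.
set D := 2 * (B * eta x) + 3 * e.
have d1 : `|a * C z - b * S z| <= D.
  move: h1 h4 h5; rewrite !ler_norml /D => /andP[? ?] /andP[? ?] /andP[? ?]; apply/andP; split; lra.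
have d2 : `|a * S z + b * C z| <= D.
  move: h2 h3 h6; rewrite !ler_norml /D => /andP[? ?] /andP[? ?] /andP[? ?]; apply/andP; split; lra.
have DK : 2 * P * D <= K0 * (B / 2).
  have : 16 * P * eta x * B <= K0 * B by rewrite ler_pM2r.
  rewrite /D; lra.
(* Inversion of the similarity by its transpose: multiplied by [C z ^+ 2 + S z ^+ 2], each of [a]
   and [b] is a combination of the two small quantities with coefficients at most [P] in absolute
   value. *)
have fin c c1 c2 : c * (C z ^+ 2 + S z ^+ 2) = c1 * C z + c2 * S z -> `|c1| <= D -> `|c2| <= D -> `|c| <= B / 2.
  move=> E h h'; rewrite -(ler_pM2l K00); apply: le_trans DK.
  apply: (@le_trans _ _ (`|c * (C z ^+ 2 + S z ^+ 2)|)).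
    by rewrite normrM mulrC ler_wpM2l// (le_trans K0le)// ler_norm.
  rewrite E (le_trans (ler_normD _ _))// !normrM.
  have -> : 2 * P * D = D * P + D * P by ring.
  by apply: lerD; rewrite ler_pM.
split.
- by apply: (fin a (a * C z - b * S z) (a * S z + b * C z)) => //; ring.
- apply: (fin b (a * S z + b * C z) (- (a * C z - b * S z))) => //; first ring.
  by rewrite normrN.
Qed.

(** The trivial bound [B] is halved indefinitely. The threshold beyond which the n-th bound holds
    depends on [n], but [x] does not. *)
Let ga_gb_cvg0 x z K0 : 0 < x -> 0 < K0 -> K0 <= C z ^+ 2 + S z ^+ 2 ->
  16 * P * eta x <= K0 ->
  ga x z u @[u --> +oo] --> (0 : R) /\ gb x z u @[u --> +oo] --> (0 : R).
Proof.
move=> x0 K00 K0le etaK; have ph := itg_fejer_dil x (lt0r_neq0 x0).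
pose B := A * \int[leb]_y `|fejer_dil x y| + 1.
have B0 : 0 < B by rewrite ltr_wpDl// mulr_ge0// Rintegral_ge0.
have it n : exists X, forall u, X < u -> `|ga x z u| <= B * 2^-1 ^+ n /\ `|gb x z u| <= B * 2^-1 ^+ n.
  elim: n => [|n IH].
    exists 0 => u _; rewrite expr0 mulr1; split; (apply: (@le_trans _ _ (A * \int[leb]_y `|fejer_dil x y|));
      [exact: wconv_bound|by rewrite lerDl]).
  have Bn : 0 < B * 2^-1 ^+ n by rewrite mulr_gt0// exprn_gt0.
  by have := contraction x z _ K0 x0 Bn K00 K0le etaK IH; rewrite exprSr mulrA.
have small e : 0 < e -> exists X, forall u, X < u -> `|ga x z u| <= e /\ `|gb x z u| <= e.
  move=> e0; have : (2^-1 : R) ^+ n @[n --> \oo] --> 0.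
    by apply: cvg_expr; rewrite gtr0_norm// invf_lt1// ltr1n.
  move=> /cvgrPdist_le/(_ (e / B) (divr_gt0 e0 B0))[n _ /(_ n (leqnn n))] /=.
  rewrite sub0r normrN ger0_norm ?exprn_ge0 ?invr_ge0// => hn.
  have [X hX] := it n; exists X => u /hX[h1 h2].
  have hB : B * 2^-1 ^+ n <= e by rewrite mulrC -ler_pdivlMr.
  by split; [exact: le_trans h1 hB|exact: le_trans h2 hB].
by split; apply/cvgyP => e /small[X hX]; exists X => u /hX[]; rewrite subr0.
Qed.

Let continuous_C : continuous C.
Proof.
move=> z; apply/(@cvg_nbhsP _ R^o) => w wz.
apply: (Rint_dct _ _ _ (fun y => `|p y|)).
- by move=> n; exact: itg_measurable (ipcos _).
- move=> y; apply: cvgMr_tmp.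
  apply: (cvg_comp (fun n => w n * y) cos (G := nbhs (z * y))); last exact: continuous_cos.
  exact: cvgMr_tmp.
- exact: itg_norm.
- by move=> n y; rewrite normrM ler_piMl// cos_norm_le.
Qed.

Let continuous_S : continuous S.
Proof.
move=> z; apply/(@cvg_nbhsP _ R^o) => w wz.
apply: (Rint_dct _ _ _ (fun y => `|p y|)).
- by move=> n; exact: itg_measurable (ipsin _).
- move=> y; apply: cvgMr_tmp.
  apply: (cvg_comp (fun n => w n * y) sin (G := nbhs (z * y))); last exact: continuous_sin.
  exact: cvgMr_tmp.
- exact: itg_norm.
- by move=> n y; rewrite normrM ler_piMl// sin_norm_le.
Qed.

Hypothesis CS : forall z,
  \int[kap]_y (cos (z * y) * p y) <> 0 \/ \int[kap]_y (sin (z * y) * p y) <> 0.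

(** The second factor of the kernel is an integral of [triangle z * cos (lam * w * z)], so only
    frequencies [lam * z] in [0, lam] occur. The squared modulus of the transform is continuous and
    has a positive minimum on this compact interval, which allows one [x] to serve all these
    frequencies; dominated convergence in [z] then gives the limit. *)
Lemma wiener_smoothing lam : 0 < lam -> exists X, forall x, X < x ->
  wconv leb (fun w => fejer (w / x) * fejer (lam * w)) g u @[u --> +oo] --> (0 : R).
Proof.
move=> lam0.
have [z0 _ z0min] : exists2 c, c \in `[0, lam] &
    forall t, t \in `[0, lam] -> C c ^+ 2 + S c ^+ 2 <= C t ^+ 2 + S t ^+ 2.
  apply: EVT_min; first exact: ltW.
  apply: continuous_subspaceT => z; apply: cvgD; rewrite !expr2.
    by apply: cvgM; exact: continuous_C.
  by apply: cvgM; exact: continuous_S.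
set K0 := C z0 ^+ 2 + S z0 ^+ 2 in z0min.
have K00 : 0 < K0.
  rewrite lt_neqAle addr_ge0 ?sqr_ge0// andbT eq_sym paddr_eq0 ?sqr_ge0// !sqrf_eq0.
  by apply/negP => /andP[/eqP c0 /eqP s0]; have [] := CS z0; [rewrite -/(C z0) c0|rewrite -/(S z0) s0].
have P0 : 0 <= P by exact: Rintegral_ge0.
have /cvgyP/(_ (K0 / (16 * (P + 1))))[] := eta_cvg0 kap p ip.
  by rewrite divr_gt0// mulr_gt0// ltr_wpDl.
move=> X hX; exists (Num.max X 0) => x; rewrite gt_max => /andP[/hX hx x0].
have etaK : 16 * P * eta x <= K0.
  move: hx; rewrite subr0 ger0_norm; last first.
    by apply: Rintegral_ge0 => y _; rewrite mulr_ge0// l1mod_ge0.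
  rewrite -/(eta x) ler_pdivlMr; last by rewrite mulr_gt0// ltr_wpDl.
  apply: le_trans; rewrite mulrC ler_wpM2l//; last by rewrite ler_pM2l// lerDl.
  by apply: Rintegral_ge0 => y _; rewrite mulr_ge0// l1mod_ge0.
have ph := itg_fejer_dil x (lt0r_neq0 x0).
pose L u z := triangle z * \int[leb]_w (g (u - w) * fejer_dil x w * cos (lam * w * z)).
have mL u : measurable_fun setT (L u).
  apply: measurable_funM; first exact: measurable_triangle.
  apply: (measurable_Rint leb (fun t : R * R => g (u - t.2) * fejer_dil x t.2 * cos (lam * t.2 * t.1))).
  apply: measurable_funM; first apply: measurable_funM.
  - by apply: (measurableT_comp mg); exact: measurable_funB.
  - by apply: (measurableT_comp (measurable_fejer_dil x)).
  - apply: (measurableT_comp (f := cos)).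
      by apply: continuous_measurable_fun; exact: continuous_cos.
    by apply: measurable_funM => //; exact: measurable_funM.
have gi u : leb.-itg (fun w => g (u - w) * fejer_dil x w) by exact: (wconv_itg _ _ _ A).
have LE u z : L u z = triangle z * (cos (lam * z * u) * ga x (lam * z) u + sin (lam * z * u) * gb x (lam * z) u).
  rewrite /L; congr (_ * _).
  have i1 := wconv_itg leb (fejer_dil x) _ A u ph (mgcos (lam * z)) (gcosA (lam * z)).
  have i2 := wconv_itg leb (fejer_dil x) _ A u ph (mgsin (lam * z)) (gsinA (lam * z)).
  rewrite /ga /gb /wconv -!RintegralZl// -RintegralD//; [|exact: itgZ..].
  apply: eq_Rintegral => w _; rewrite /gcos /gsin.
  have -> : lam * w * z = lam * z * u - lam * z * (u - w) by ring.
  by rewrite cosB; ring.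
have L0 z : L u z @[u --> +oo] --> (0 : R).
  rewrite (@eq_cvg _ _ _ _ (fun u => triangle z * (cos (lam * z * u) * ga x (lam * z) u + sin (lam * z * u) * gb x (lam * z) u)))//.
  have [z01|z01] := boolP (z \in `[0, 1]%classic); last first.
    rewrite /triangle indicE (negbTE z01) mulr0.
    rewrite (@eq_cvg _ _ _ _ (fun=> 0)); first exact: cvg_cst.
    by move=> u; rewrite mul0r.
  have zl : lam * z \in `[0, lam].
    move: z01; rewrite inE/= !in_itv/= => /andP[z0' z1].
    by apply/andP; split; [exact: mulr_ge0 (ltW lam0) z0'|rewrite ler_piMr// ltW].
  have [h1 h2] := ga_gb_cvg0 x (lam * z) K0 x0 K00 (z0min _ zl) etaK.
  have bd (h f : R -> R) : (forall u, `|h u| <= 1) -> f u @[u --> +oo] --> (0 : R) ->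
     h u * f u @[u --> +oo] --> (0 : R).
    move=> hb /cvgyP fc; apply/cvgyP => e /fc[Y hY]; exists Y => u /hY.
    by rewrite !subr0 normrM; apply: le_trans; rewrite ler_piMl.
  suff : triangle z * (cos (lam * z * u) * ga x (lam * z) u + sin (lam * z * u) * gb x (lam * z) u)
      @[u --> +oo] --> triangle z * (0 + 0) by rewrite addr0 mulr0.
  apply: cvgMl_tmp; apply: cvgD; apply: bd => // u; [exact: cos_norm_le|exact: sin_norm_le].
pose F u (t : R * R) : R := g (u - t.1) * cos (lam * t.1 * t.2) * (fejer_dil x t.1 * triangle t.2).
have Fi u : (leb \x leb)%E.-itg (F u).
  apply: (itg_bddM _ _ _ A).
  - exact: itg_prod ph itg_triangle.
  - apply: measurable_funM; first by apply: (measurableT_comp mg); exact: measurable_funB.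
    apply: (measurableT_comp (f := cos)).
      by apply: continuous_measurable_fun; exact: continuous_cos.
    by apply: measurable_funM => //; exact: measurable_funM.
  - by move=> t; rewrite normrM -[A]mulr1 ler_pM// cos_norm_le.
have E u : wconv leb (fun w => fejer (w / x) * fejer (lam * w)) g u = \int[leb]_z L u z.
  transitivity (\int[leb]_w \int[leb]_z F u (w, z)).
    apply: eq_Rintegral => w _; rewrite {2}/fejer mulrA -RintegralZl//; last exact: itg_triangle_cos.
    by apply: eq_Rintegral => z _; rewrite /F/= /fejer_dil; ring.
  rewrite Rint_fubini//; apply: eq_Rintegral => z _; rewrite /L -RintegralZl//.
    by apply: eq_Rintegral => w _; rewrite /F/=; ring.
  have mc : measurable_fun setT (fun w : R => cos (lam * w * z)).
    apply: (measurableT_comp (f := cos)).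
      by apply: continuous_measurable_fun; exact: continuous_cos.
    by apply: measurable_funM => //; exact: measurable_funM.
  have := itg_bddM _ _ _ 1 (gi u) mc (fun=> cos_norm_le _).
  by apply: eq_integrable => // w _ /=; rewrite mulrC.
suff LL : \int[leb]_z L u z @[u --> +oo] --> (0 : R) by rewrite (eq_cvg _ _ E); exact: LL.
have -> : (0 : R) = \int[leb]_z (0 : R) by rewrite Rintegral_cst// mul0r.
have hi : leb.-itg (fun z => (A * \int[leb]_w `|fejer_dil x w|) * triangle z) by exact/itgZ/itg_triangle.
apply: (Rint_dct_pinfty leb L (fun=> 0) _ mL L0 hi).
near=> u => z; rewrite /L normrM mulrC (ger0_norm (triangle_ge0 z)) ler_wpM2r ?triangle_ge0//.
rewrite -RintegralZl//; last exact: itg_norm.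
apply: Rint_norm_le.
- apply: measurable_funM; first exact: itg_measurable (gi u).
  apply: (measurableT_comp (f := cos)).
    by apply: continuous_measurable_fun; exact: continuous_cos.
  by apply: measurable_funM => //; exact: measurable_funM.
- exact/itgZ/itg_norm.
- move=> w; rewrite !normrM -[leRHS]mulr1 ler_pM ?cos_norm_le ?mulr_ge0//.
  by rewrite ler_wpM2r.
Unshelve. all: by end_near.
Qed.

End Wiener.

(** * Approximate identity and removal of the smoothing *)

Section WienerPitt.
Context {R : realType}.

Definition outer_indic (d w : R) : R := \1_[set w | d < `|w|] w.

Lemma outer_indicE (d w : R) : outer_indic d w = if d < `|w| then 1 else 0.
Proof.
rewrite /outer_indic indicE; case: ifPn => h; first by rewrite mem_set.
by rewrite memNset//; exact/negP.
Qed.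

Lemma measurable_outer_indic (d : R) : measurable_fun setT (outer_indic d).
Proof.
apply: measurable_indic.
have -> : [set w : R | d < `|w|] = (fun w : R => d < `|w|) @^-1` [set true].
  by apply/seteqP; split.
rewrite -[X in measurable X]setTI.
apply: (measurable_fun_ltr (f := cst d) (g := fun w : R => `|w|)) => //.
Qed.

Lemma outer_indic_ge0 (d w : R) : 0 <= outer_indic d w.
Proof. by rewrite outer_indicE; case: ifP. Qed.

Lemma outer_indic_le1 (d w : R) : `|outer_indic d w| <= 1.
Proof. by rewrite outer_indicE; case: ifP; rewrite ?normr1 ?normr0. Qed.

Lemma fejer_tail_cvg0 : \int[leb]_v (outer_indic L v * fejer v) @[L --> +oo] --> (0 : R).
Proof.
have -> : (0 : R) = \int[leb]_v (0 : R) by rewrite Rintegral_cst// mul0r.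
apply: (Rint_dct_pinfty leb (fun L v => outer_indic L v * fejer v) (fun=> 0) fejer _ _ itg_fejer).
- by move=> L; apply: measurable_funM; [exact: measurable_outer_indic|exact: measurable_fejer].
- move=> v; apply/cvgyP => e e0; exists `|v| => L vL.
  by rewrite outer_indicE ltNge (ltW vL) mul0r subrr normr0 ltW.
- near=> L => v; rewrite normrM (@ger0_norm _ (fejer v)) ?fejer_ge0//.
  by rewrite ler_piMl ?fejer_ge0// outer_indic_le1.
Unshelve. all: by end_near.
Qed.

(* A second Fejer kernel, of large band width [lam], makes [fejer_prod] an approximate
   identity; the first factor is the narrow-band kernel of [wiener_smoothing]. *)
Definition fejer_prod (lam x w : R) : R := fejer (w / x) * fejer (lam * w).

Lemma fejer_prod_ge0 (lam x w : R) : 0 <= fejer_prod lam x w.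
Proof. by rewrite mulr_ge0// fejer_ge0. Qed.

Lemma itg_fejer_scale (lam : R) : 0 < lam -> leb.-itg (fun w => fejer (lam * w)).
Proof.
move=> l0; have := itg_fejer_affine lam 0 (lt0r_neq0 l0).
by apply: eq_integrable => // w _ /=; rewrite addr0.
Qed.

Lemma itg_fejer_prod (lam x : R) : 0 < lam -> leb.-itg (fejer_prod lam x).
Proof.
move=> l0; apply: (itg_bddM _ _ _ 2^-1 (itg_fejer_scale lam l0)).
- by apply: (measurableT_comp measurable_fejer); exact: measurable_funM.
- by move=> w; rewrite ger0_norm ?fejer_le ?fejer_ge0.
Qed.

Lemma fejer_ge_quarter (u : R) : `|u| <= 4^-1 -> 4^-1 <= fejer u.
Proof.
by move=> u1; have := fejer_lipschitz 0 u; rewrite fejer0 sub0r normrN ler_norml; lra.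
Qed.

(** Both factors are at least 1/4 on [[0, (4 * lam)^-1]] when [x] and [lam] are at least 1, so the
    total mass is at least [lam^-1 / 64], whatever [x]. Outside [[- d, d]] the first factor is at
    most 1/2 and the second has mass [lam^-1] times the mass of [fejer] beyond [lam * d], which is
    relatively small once [lam] is large. *)
Lemma fejer_prod_concentrated (d theta : R) : 0 < d -> 0 < theta -> exists2 lam : R, 0 < lam &
  forall x, 1 <= x -> 0 < \int[leb]_w fejer_prod lam x w /\
    \int[leb]_w (outer_indic d w * fejer_prod lam x w) <= theta * \int[leb]_w fejer_prod lam x w.
Proof.
move=> d0 t0; have /cvgyP/(_ (theta / 32))[] := fejer_tail_cvg0; first by rewrite divr_gt0.
(* [L = lam * d] is the cut-off after rescaling: it must exceed [X], and [d] as well to ensure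
   [1 <= lam]. *)
move=> X hX; pose L := Num.max (`|X| + 1) d.
have L0 : 0 < L by rewrite lt_max d0 orbT.
have XL : X < L.
  by rewrite lt_max (le_lt_trans (ler_norm X))// ltrDl.
pose lam := L / d; have l0 : 0 < lam by rewrite divr_gt0.
have l1 : 1 <= lam by rewrite ler_pdivlMr// mul1r le_max lexx orbT.
have ln0 := lt0r_neq0 l0.
exists lam => // x x1; have x0 : 0 < x by apply: lt_le_trans x1.
have ki := itg_fejer_prod lam x l0.
have lower : lam^-1 / 64 <= \int[leb]_w fejer_prod lam x w.
  pose J : set R := `[0, (4 * lam)^-1]%classic.
  have mJ : measurable J by exact: measurable_itv.
  have iJ : leb.-itg (\1_J : R -> R).
    by apply/integrable_leb => //; exact: integrable_indic_itv.
  have -> : lam^-1 / 64 = \int[leb]_w (16^-1 * \1_J w).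
    rewrite RintegralZl// /Rintegral integral_indic// setIT.
    rewrite [X in fine X](_ : _ = ((4 * lam)^-1)%:E)/=; first by field.
    change (@lebesgue_measure R J = ((4 * lam)^-1)%:E).
    by rewrite lebesgue_measure_itv/= lte_fin invr_gt0 mulr_gt0//= -EFinD subr0.
  apply: Rint_le => // [|w]; first exact: itgZ.
  rewrite indicE; case: (boolP (w \in J)) => [|_]; last by rewrite mulr0 fejer_prod_ge0.
  rewrite inE /J/= in_itv/= mulr1 => /andP[w0 w1].
  have -> : 16^-1 = 4^-1 * 4^-1 :> R by field.
  have lw : lam * w <= 4^-1 by rewrite mulrC -ler_pdivlMr// -invfM.
  apply: ler_pM => //; apply: fejer_ge_quarter.
  - rewrite ger0_norm ?divr_ge0//; last exact: ltW.
    apply: le_trans lw; apply: (@le_trans _ _ w).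
      by rewrite ler_pdivrMr// ler_peMr.
    by rewrite ler_peMl.
  - by rewrite ger0_norm// mulr_ge0// ltW.
have lV : 0 < lam^-1 by rewrite invr_gt0.
split; first by apply: lt_le_trans lower; rewrite divr_gt0.
have mo := measurable_outer_indic d.
have oL v : outer_indic d (lam^-1 * v + 0) = outer_indic L v.
  rewrite !outer_indicE addr0 normrM gtr0_norm// mulrC ltr_pdivlMr//.
  by rewrite /lam mulrCA divff ?mulr1// gt_eqF.
have oi : leb.-itg (fun v => outer_indic L v * fejer v).
  by apply: (itg_bddM _ _ _ 1 itg_fejer (measurable_outer_indic L)) => v; exact: outer_indic_le1.
have := Rintegral_leb_affine R lam 0 _ ln0 oi; rewrite gtr0_norm// => h.
have oi' := integrable_leb_affine R lam 0 _ ln0 oi.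
have up : \int[leb]_w (outer_indic d w * fejer_prod lam x w) <= 2^-1 * (lam^-1 * \int[leb]_v (outer_indic L v * fejer v)).
  rewrite -h -RintegralZl//; apply: Rint_le.
  - by apply: (itg_bddM _ _ _ 1 ki mo) => v; exact: outer_indic_le1.
  - exact: itgZ.
  - move=> w; have <- : outer_indic d w = outer_indic L (lam * w + 0).
      by rewrite -oL !addr0 mulKf.
    by rewrite /fejer_prod addr0 mulrCA ler_wpM2r ?mulr_ge0 ?outer_indic_ge0 ?fejer_ge0// fejer_le.
apply: (le_trans up).
have := hX L XL; rewrite subr0 => /(le_trans (ler_norm _)) hL.
apply: (@le_trans _ _ (theta * (lam^-1 / 64))); last by rewrite ler_pM2l.
have -> : theta * (lam^-1 / 64) = 2^-1 * (lam^-1 * (theta / 32)) by field.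
by rewrite ler_pM2l// ler_pM2l.
Qed.

(** The one-sided bound suffices to undo the smoothing at two different centres. Around [y - d] all
    nearby values of [f] are at least [f y / (1 + s)], which bounds [f y] above; around [y + d] they
    are at most [(1 + s) * f y], which bounds it below. Values farther than [d] are at most [A] and
    carry a fraction [th] of the mass. *)
Theorem wiener_pitt (kap : {sigma_finite_measure set R -> \bar R}) (p f : R -> R) (A c : R) :
  kap.-itg p ->
  (forall z, \int[kap]_y (cos (z * y) * p y) <> 0 \/ \int[kap]_y (sin (z * y) * p y) <> 0) ->
  measurable_fun setT f -> (forall x, 0 <= f x <= A) ->
  (forall e, 0 < e -> exists2 d, 0 < d & exists X, forall x t, X < x -> 0 <= t <= d ->
     f (x + t) <= (1 + e) * f x) ->
  wconv kap p f x @[x --> +oo] --> c * \int[kap]_y p y ->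
  f x @[x --> +oo] --> c.
Proof.
(* In both estimates [M] is the mass of the kernel, [I] the smoothed value of [f], and [T] bounds
   the contribution of distances beyond [d]. *)
have upper_bound (y s M I T c' : R) : 0 < M -> 0 < s -> y * M <= (1 + s) * I + T ->
    T <= s * M -> I - c' * M <= s * M -> y <= (1 + s) * (c' + s) + s.
  move=> M0 s0 h1 h2 h3; rewrite -(ler_pM2r M0); apply: (le_trans h1).
  have : (1 + s) * I <= (1 + s) * ((c' + s) * M) by rewrite ler_pM2l; lra.
  lra.
have lower_bound (y s M I T c' : R) : 0 < M -> I <= (1 + s) * (y * M) + T ->
    T <= s * M -> - (s * M) <= I - c' * M -> c' - 2 * s <= (1 + s) * y.
  by move=> M0 h1 h2 h3; rewrite -(ler_pM2r M0); lra.
move=> ip CS mf fA slow fp; apply/cvgyP => e e0.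
have f0 x : 0 <= f x by have /andP[] := fA x.
have fA' x : f x <= A by have /andP[] := fA x.
have A0 : 0 <= A := le_trans (f0 0) (fA' 0).
have fn x : `|f x| <= A by rewrite ger0_norm.
pose g x := f x - c.
have mg : measurable_fun setT g by exact: measurable_funB.
have gA x : `|g x| <= A + `|c| by rewrite (le_trans (ler_normB _ _))// lerD2r.
have gp : wconv kap p g x @[x --> +oo] --> (0 : R).
  rewrite (@eq_cvg _ _ _ _ (fun x => wconv kap p f x - c * \int[kap]_y p y)); last first.
    by move=> x; rewrite (wconvB _ _ _ _ A `|c|)// wconv_cst.
  suff: (fun x => wconv kap p f x - c * \int[kap]_y p y) x @[x --> +oo] -->
     c * (\int[kap]_y p y) - c * \int[kap]_y p y by rewrite subrr.
  by apply: cvgB; [exact: fp|exact: cvg_cst].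
(* For [s <= 1] the final bounds are [f y <= c + s * (3 + |c|)] and [f y >= c - s * (2 + A)]; [Q]
   covers both. *)
pose Q := 3 + `|c| + A; have Q0 : 0 < Q by rewrite /Q; have := normr_ge0 c; lra.
pose s := Num.min 1 (e / Q).
have s0 : 0 < s by rewrite lt_min ltr01 divr_gt0.
have s1 : s <= 1 by rewrite ge_min lexx.
have sQ : s * Q <= e by rewrite -ler_pdivlMr// ge_min lexx orbT.
have [d2 d20 [X1 slw]] := slow s s0.
(* The shifts [d + w] and [d - w] with [|w| <= d] go up to [2 * d]. *)
pose d := d2 / 2; have d0 : 0 < d by rewrite divr_gt0.
pose th := s / (A + 1); have A1 : 0 < A + 1 by rewrite ltr_wpDl.
have th0 : 0 < th by rewrite divr_gt0.
have Ath : A * th <= s.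
  by rewrite /th mulrCA ler_piMr ?(ltW s0)// ler_pdivrMr// mul1r lerDl.
have [lam l0 conc] := fejer_prod_concentrated d th d0 th0.
have [X2 smooth] := wiener_smoothing kap p g _ ip mg gA gp CS lam l0.
pose x := Num.max 1 (`|X2| + 1).
have x1 : 1 <= x by rewrite le_max lexx.
have xX2 : X2 < x by apply: (le_lt_trans (ler_norm X2)); rewrite lt_max ltrDl ltr01 orbT.
have [M0 outM] := conc x x1.
set M := \int[leb]_w fejer_prod lam x w in M0 outM.
have ki := itg_fejer_prod lam x l0.
have /cvgyP/(_ (s * M) (mulr_gt0 s0 M0))[X3 h3] := smooth x xX2.
have oi : leb.-itg (fun w => outer_indic d w * fejer_prod lam x w).
  by apply: (itg_bddM _ _ _ 1 ki (measurable_outer_indic d)) => v; exact: outer_indic_le1.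
have IE u : wconv leb (fejer_prod lam x) g u = wconv leb (fejer_prod lam x) f u - c * M.
  by rewrite (wconvB _ _ _ _ A `|c|)// wconv_cst.
have near0 w : ~~ (d < `|w|) -> - d <= w <= d by rewrite -leNgt ler_norml.
have up u : X1 + d < u -> f (u + d) * M <= (1 + s) * wconv leb (fejer_prod lam x) f u + A * (th * M).
  move=> uX; have fi := wconv_itg leb (fejer_prod lam x) f A u ki mf fn.
  apply: (@le_trans _ _ ((1 + s) * wconv leb (fejer_prod lam x) f u + A * \int[leb]_w (outer_indic d w * fejer_prod lam x w))); last first.
    by rewrite lerD2l ler_wpM2l.
  rewrite /M /wconv -!RintegralZl// -RintegralD//; [|exact: itgZ..].
  apply: Rint_le => [||w]; [exact: itgZ|by apply: itgD; exact: itgZ|].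
  move: (fejer_prod lam x w) (fejer_prod_ge0 lam x w) => k k0.
  rewrite !mulrA -mulrDl ler_wpM2r// outer_indicE; case: ifPn => [_|/near0/andP[w1 w2]].
    by rewrite mulr1 (le_trans (fA' _))// lerDr mulr_ge0// addr_ge0// ltW.
  rewrite mulr0 addr0; have -> : u + d = (u - w) + (d + w) by ring.
  by apply: slw; rewrite /d in w1 w2 uX *; lra.
have lo u : X1 + d < u -> wconv leb (fejer_prod lam x) f u <= (1 + s) * (f (u - d) * M) + A * (th * M).
  move=> uX; have fi := wconv_itg leb (fejer_prod lam x) f A u ki mf fn.
  apply: (@le_trans _ _ ((1 + s) * (f (u - d) * M) + A * \int[leb]_w (outer_indic d w * fejer_prod lam x w))); last first.
    by rewrite lerD2l ler_wpM2l.
  rewrite /M /wconv -!RintegralZl//; last exact: itgZ.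
  rewrite -RintegralD//; [|by apply: itgZ; exact: itgZ|exact: itgZ].
  apply: Rint_le => [||w]; [exact: fi|by apply: itgD; do ?exact: itgZ; apply: itgZ; exact: itgZ|].
  move: (fejer_prod lam x w) (fejer_prod_ge0 lam x w) => k k0.
  rewrite !mulrA -mulrDl ler_wpM2r// outer_indicE; case: ifPn => [_|/near0/andP[w1 w2]].
    by rewrite mulr1 (le_trans (fA' _))// lerDr mulr_ge0// addr_ge0// ltW.
  rewrite mulr0 addr0; have -> : u - w = (u - d) + (d - w) by ring.
  by apply: slw; rewrite /d in w1 w2 uX *; lra.
pose Y := Num.max (X1 + d) X3 + d.
have fs y : f y * s <= A * s by rewrite ler_wpM2r// ltW.
exists Y => y yY.
have := ler_norm c; have := ler_norm (- c); rewrite normrN => cN cP.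
have yY1 : X1 + d < y - d /\ X3 < y - d.
  by apply/andP; rewrite -gt_max; rewrite /Y in yY; lra.
have yY2 : X1 + d < y + d /\ X3 < y + d by move: yY1 => [? ?]; split; lra.
have cc : s * c <= s * `|c| by rewrite ler_pM2l.
have ss : s * s <= s by rewrite ler_piMr// ltW.
have AthM : A * (th * M) <= s * M by rewrite mulrA ler_pM2r.
have U : f y <= (1 + s) * (c + s) + s.
  have := up (y - d) yY1.1; rewrite subrK => hu.
  have := h3 _ yY1.2; rewrite subr0 => /(le_trans (ler_norm _)); rewrite -/(fejer_prod lam x) IE => hi.
  exact: upper_bound M0 s0 hu AthM hi.
have D : c - 2 * s <= (1 + s) * f y.
  have := lo (y + d) yY2.1; rewrite addrK => hu.
  have := h3 _ yY2.2; rewrite subr0 ler_norml -/(fejer_prod lam x) IE => /andP[hi _].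
  exact: lower_bound M0 hu AthM hi.
have fsy := fs y; rewrite /Q in sQ.
have sA : 0 <= s * A by rewrite mulr_ge0// ltW.
have sc : 0 <= s * `|c| by rewrite mulr_ge0// ltW.
clear -U D fsy sQ cc ss sA sc s0; rewrite ler_norml; apply/andP; split; lra.
Qed.
End WienerPitt.

(** * Tails of convolutions *)

Section convolution.
Context {R : realType}.
Implicit Types (P Q : probability R R) (h : R -> R) (x y K : R).

(** Zero at 0, to match the open half-lines in [tail]. Tails become integrals of a monotone
    function, ready for Fubini. *)
Definition heaviside (x : R) : R := if 0 < x then 1 else 0.

Lemma heaviside_ge0 x : 0 <= heaviside x. Proof. by rewrite /heaviside; case: ifP. Qed.
Lemma heaviside_le1 x : heaviside x <= 1. Proof. by rewrite /heaviside; case: ifP. Qed.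
Lemma heaviside_norm x : `|heaviside x| <= 1. Proof. by rewrite ger0_norm ?heaviside_le1 ?heaviside_ge0. Qed.

Lemma heaviside_homo x y : x <= y -> heaviside x <= heaviside y.
Proof.
move=> xy; rewrite /heaviside; case: ifPn => x0; last by case: ifP.
by rewrite (lt_le_trans x0 xy).
Qed.

Lemma measurable_heaviside : measurable_fun setT heaviside.
Proof. by apply: nondecreasing_measurable => // x y; exact: heaviside_homo. Qed.

Lemma measurable_heaviside_comp d (T : measurableType d) (f : T -> R) :
  measurable_fun setT f -> measurable_fun setT (fun t => heaviside (f t)).
Proof. exact: measurableT_comp measurable_heaviside. Qed.

Lemma tail_heaviside P x : tail P x = \int[P]_y heaviside (y - x).
Proof.
rewrite /tail /Rintegral -(setIT `]x, +oo[%classic) -integral_indic//; congr fine.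
apply: eq_integral => y _; congr EFin; rewrite indicE /heaviside subr_gt0.
case: ifPn => h; first by rewrite mem_set//= in_itv/= h.
by rewrite memNset//= in_itv/= andbT; exact/negP.
Qed.

Lemma itg_heaviside P (f : R -> R) : measurable_fun setT f -> P.-itg (fun y => heaviside (f y)).
Proof.
by move=> mf; apply: (itg_bdd _ _ 1); [exact: measurable_heaviside_comp|move=> y; exact: heaviside_norm].
Qed.

Lemma tail_ge0 P x : 0 <= tail P x.
Proof. by rewrite fine_ge0. Qed.

Lemma tail_le1 P x : tail P x <= 1.
Proof.
rewrite /tail -lee_fin fineK ?fin_num_measure//; exact: probability_le1.
Qed.

Lemma tail_norm P x : `|tail P x| <= 1.
Proof. by rewrite ger0_norm ?tail_ge0 ?tail_le1. Qed.

Lemma tail_homo P x y : x <= y -> tail P y <= tail P x.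
Proof.
move=> xy; rewrite !tail_heaviside; apply: Rint_le => [||t]; try by apply: itg_heaviside; exact: measurable_funB.
by apply: heaviside_homo; rewrite lerD2l lerN2.
Qed.

Lemma measurable_tail P : measurable_fun setT (tail P).
Proof. by apply: nonincreasing_measurable => // x y; exact: tail_homo. Qed.

Lemma measurable_addp : measurable_fun setT (fun z : R * R => z.1 + z.2).
Proof. exact: measurable_funD. Qed.

Definition convolution P Q : set R -> \bar R := pushforward (P \x Q)%E (fun z : R * R => z.1 + z.2).

Section instances.
Variables P Q : probability R R.

HB.instance Definition _ := Measure.copy (convolution P Q)
  (measure_function_pushforward__canonical__measure_function_Measure (P \x Q)%E measurable_addp).

Let convpT : convolution P Q setT = 1%E.
Proof.
rewrite /convolution /pushforward preimage_setT -setXTT product_measure1E//.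
by rewrite [X in (X * _)%E]probability_setT [X in (_ * X)%E]probability_setT mule1.
Qed.

HB.instance Definition _ := Measure_isProbability.Build _ _ _ (convolution P Q) convpT.
End instances.

Lemma itg_convolution P Q h : measurable_fun setT h ->
  (P \x Q)%E.-itg (fun z => h (z.1 + z.2)) -> (convolution P Q).-itg h.
Proof.
move=> mh hi; apply: (integrable_pushforward measurable_addp (f := EFin \o h)) => //.
exact/measurable_EFinP.
Qed.

Lemma Rint_convolution P Q h : measurable_fun setT h ->
  (P \x Q)%E.-itg (fun z => h (z.1 + z.2)) ->
  \int[convolution P Q]_t h t = \int[P]_x \int[Q]_y h (x + y).
Proof.
move=> mh hi; have := Rint_Rint _ _ _ hi => /= ->.
rewrite /Rintegral; congr fine.
apply: (integral_pushforward measurable_addp (f := EFin \o h)) => //.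
exact/measurable_EFinP.
Qed.

Lemma itg_prod_bdd P Q (F : R * R -> R) A : measurable_fun setT F ->
  (forall z, `|F z| <= A) -> (P \x Q)%E.-itg F.
Proof.
move=> mF FA; have i1 : (P \x Q)%E.-itg (fun z : R * R => cst 1 z.1 * cst 1 z.2).
  by apply: itg_prod; exact: finite_measure_integrable_cst.
have := itg_bddM _ _ _ A i1 mF FA.
by apply: eq_integrable => // z _ /=; rewrite !mulr1.
Qed.

Lemma tail_convolution P Q x : tail (convolution P Q) x = \int[Q]_y tail P (x - y).
Proof.
have i : (P \x Q)%E.-itg (fun z : R * R => heaviside (z.1 + z.2 - x)).
  apply: (itg_prod_bdd _ _ _ 1) => [|z]; last exact: heaviside_norm.
  by apply: measurable_heaviside_comp; apply: measurable_funB => //; exact: measurable_addp.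
rewrite tail_heaviside Rint_convolution//; last by apply: measurable_heaviside_comp; exact: measurable_funB.
rewrite (Rint_fubini _ _ (fun z : R * R => heaviside (z.1 + z.2 - x)))//.
by apply: eq_Rintegral => y _; rewrite tail_heaviside; apply: eq_Rintegral => t _ /=; congr heaviside; ring.
Qed.

Lemma measurable_shift (y : R) : measurable_fun setT (fun x : R => x + y).
Proof. exact: measurable_funD. Qed.

Lemma convolutionE P Q (A : set R) : measurable A -> convolution P Q A = Defs.conv P Q A.
Proof.
move=> mA; have mI : measurable_fun setT (fun z : R * R => (\1_A (z.1 + z.2) : R)%:E).
  by apply/measurable_EFinP; apply: (measurableT_comp _ measurable_addp).
transitivity (\int[convolution P Q]_t (\1_A t : R)%:E)%E; first by rewrite integral_indic// setIT.
have I0 (z : R * R) : (0 <= (\1_A (z.1 + z.2) : R)%:E)%E by rewrite lee_fin.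
have T := @fubini_tonelli2 _ _ _ _ _ P Q (fun z : R * R => (\1_A (z.1 + z.2) : R)%:E) mI I0.
refine (etrans _ (etrans T _)).
  apply: (@ge0_integral_pushforward _ _ _ _ _ _ measurable_addp _ setT (EFin \o \1_A)) => //.
    exact/measurable_EFinP.
  by move=> y _; rewrite lee_fin.
apply: eq_integral => y _; rewrite /fubini_G/=.
have mp : measurable ((fun x : R => x + y) @^-1` A).
  rewrite -[X in measurable X]setTI.
  exact: (measurable_shift y measurableT _ mA).
transitivity (\int[P]_x (\1_((fun x : R => (x + y)%R) @^-1` A) x : R)%:E)%E; first by [].
by rewrite integral_indic// setIT.
Qed.

Fixpoint conv_pow P n : probability R R :=
  if n is n'.+1 then convolution (conv_pow P n') P else \d_(0 : R).

Lemma conv_powE P n (A : set R) : measurable A -> conv_pow P n A = convpow P n A.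
Proof.
elim: n A => [|n IH] A mA; first by rewrite /= diracE indicE.
transitivity (convolution (conv_pow P n) P A); first by [].
rewrite convolutionE//=; apply: eq_integral => y _; apply: IH.
rewrite -[X in measurable X]setTI.
exact: (measurable_shift y measurableT _ mA).
Qed.
End convolution.

(** * A single big jump *)

Section big_jump.
Context {R : realType}.
Variables (gam : R) (rho : probability R R).
Hypotheses (gam0 : 0 < gam) (rhoS : classS gam rho).
Implicit Types (P Q : probability R R) (x y K C : R).

Let r := tail rho.
Let E y : R := expR (gam * y).
(** The indicator of [y <= K], written as a complement so that cutting an integral at [K] is a ring
    identity. *)
Let lv K y : R := 1 - heaviside (y - K).

Lemma classS_tail_gt0 x : 0 < tail rho x.
Proof. by have [[h _] _] := rhoS; exact: h. Qed.

Let r0 := classS_tail_gt0.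

Let measurable_E : measurable_fun setT E.
Proof. by apply: (measurableT_comp (f := expR)) => //; exact: measurable_funM. Qed.

Let lv_ge0 K y : 0 <= lv K y. Proof. by rewrite subr_ge0 heaviside_le1. Qed.
Let lv_le1 K y : lv K y <= 1. Proof. by rewrite gerBl heaviside_ge0. Qed.
Let lv_norm K y : `|lv K y| <= 1. Proof. by rewrite ger0_norm. Qed.
Let lvE K y : lv K y = if K < y then 0 else 1.
Proof. by rewrite /lv /heaviside subr_gt0; case: ifP; rewrite ?subrr ?subr0. Qed.
Let measurable_lv K : measurable_fun setT (lv K).
Proof. by apply: measurable_funB => //; apply: measurable_heaviside_comp; exact: measurable_funB. Qed.
Let measurable_heavisideK K : measurable_fun setT (fun y => heaviside (y - K)).
Proof. by apply: measurable_heaviside_comp; exact: measurable_funB. Qed.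

Lemma tail_ratio_cvg y : tail rho (x - y) / tail rho x @[x --> +oo] --> expR (gam * y).
Proof.
have [[_ /(_ (- y)) h] _] := rhoS.
suff: expR (gam * y) * (tail rho (x - y) / (expR (- gam * - y) * tail rho x)) @[x --> +oo]
    --> expR (gam * y) * 1.
  rewrite mulr1 mulrNN; apply: cvg_trans; apply: near_eq_cvg; near=> x.
  by field; rewrite !gt_eqF ?expR_gt0//; exact: r0.
by apply: cvgM; [exact: cvg_cst|exact: h].
Unshelve. all: by end_near.
Qed.

Definition tail_dom C P := forall x, tail P x <= C * tail rho x.

Lemma tail_dom_ge0 C P : tail_dom C P -> 0 <= C.
Proof.
by move=> /(_ 0) h; have := le_trans (tail_ge0 P 0) h; rewrite pmulr_lge0// r0.
Qed.

Definition rel_tail P x := tail P x / tail rho x.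

Lemma rel_tail_ge0 P x : 0 <= rel_tail P x.
Proof. by rewrite divr_ge0// tail_ge0. Qed.

Lemma rel_tail_le C P x : tail_dom C P -> rel_tail P x <= C.
Proof. by move=> h; rewrite ler_pdivrMr ?r0. Qed.

Lemma rel_tail_norm C P x : tail_dom C P -> `|rel_tail P x| <= C.
Proof. by move=> h; rewrite ger0_norm ?rel_tail_ge0// rel_tail_le. Qed.

Lemma measurable_rel_tail P : measurable_fun setT (rel_tail P).
Proof.
apply: measurable_funM; first exact: measurable_tail.
apply: nondecreasing_measurable => // x y xy.
by rewrite lef_pV2 ?posrE ?r0// tail_homo.
Qed.

Lemma rel_tailM P x : rel_tail P x * tail rho x = tail P x.
Proof. by rewrite /rel_tail divfK// gt_eqF// r0. Qed.

Let trunc P Q K x := \int[Q]_y (lv K y * tail P (x - y)).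
Let rem P Q K x := \int[Q]_y (heaviside (y - K) * tail P (Num.max (x - y) K)).

Let itg_lvtail P Q K x : Q.-itg (fun y => lv K y * tail P (x - y)).
Proof.
apply: (itg_bdd _ _ 1).
  by apply: measurable_funM => //; apply: measurable_reflect; exact: measurable_tail.
by move=> y; rewrite normrM -[1]mulr1 ler_pM// tail_norm.
Qed.

(** For [y <= K] the ratio of rho's tails at [x - y] and [x] tends to [E y], whereas the relative
    tail of [P] at [x - y] has no known limit and stays inside the integral. *)
Let trunc_cvg C P Q K : tail_dom C P ->
  trunc P Q K x / r x - \int[Q]_y (lv K y * (rel_tail P (x - y) * E y)) @[x --> +oo] --> (0 : R).
Proof.
move=> dP; have C0 := tail_dom_ge0 C P dP.
pose F x y := lv K y * (rel_tail P (x - y) * (r (x - y) / r x - E y)).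
have mF x : measurable_fun setT (F x).
  apply: measurable_funM => //; apply: measurable_funM.
    by apply: measurable_reflect; exact: measurable_rel_tail.
  apply: measurable_funB => //; apply: measurable_funM => //.
  by apply: measurable_reflect; exact: measurable_tail.
have lvE_le y : lv K y * E y <= E K.
  rewrite lvE; case: ifPn; rewrite ?mul0r ?expR_ge0// -leNgt mul1r => yK.
  by rewrite ler_expR ler_pM2l.
have ilvE x : Q.-itg (fun y => lv K y * (rel_tail P (x - y) * E y)).
  apply: (itg_bdd _ _ (C * E K)).
    apply: measurable_funM => //; apply: measurable_funM => //.
    by apply: measurable_reflect; exact: measurable_rel_tail.
  move=> y; rewrite mulrCA normrM ler_pM ?rel_tail_norm//.
  by rewrite ger0_norm// mulr_ge0// expR_ge0.
have FE x : trunc P Q K x / r x - \int[Q]_y (lv K y * (rel_tail P (x - y) * E y)) = \int[Q]_y F x y.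
  have -> : trunc P Q K x / r x = \int[Q]_y (lv K y * tail P (x - y) * (r x)^-1).
    by rewrite RintegralZr//; exact: itg_lvtail.
  rewrite -RintegralB//; last first.
    by have := itgZ _ _ (r x)^-1 (itg_lvtail P Q K x); apply: eq_integrable => // y _ /=; rewrite mulrC.
  by apply: eq_Rintegral => y _; rewrite /F -(rel_tailM P (x - y)) -/r; ring.
suff: \int[Q]_y F x y @[x --> +oo] --> (0 : R) by rewrite (eq_cvg _ _ FE).
have -> : (0 : R) = \int[Q]_y (0 : R) by rewrite Rintegral_cst// mul0r.
(* For [y <= K] and large [x], monotonicity bounds the ratio of rho's tails by its value at [y = K],
   hence by [E K + 1]; the last [E K] bounds [E y]. *)
have iK : Q.-itg (cst (C * (E K + 1 + E K))) by exact: finite_measure_integrable_cst.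
apply: (Rint_dct_pinfty Q F (fun=> 0) _ mF _ iK).
- move=> y; apply/cvgyP => e e0.
  have /cvgyP/(_ (e / (C + 1)))[] := tail_ratio_cvg y; first by rewrite divr_gt0// ltr_wpDl.
  move=> X hX; exists X => x /hX h; rewrite subr0 /F normrM.
  apply: (@le_trans _ _ (1 * (C * (e / (C + 1))))).
    by rewrite ler_pM// normrM ler_pM// rel_tail_norm.
  by rewrite mul1r mulrCA ler_piMr// ?(ltW e0)// ler_pdivrMr ?mul1r ?lerDl// ltr_wpDl.
- have /cvgyP/(_ 1 ltr01)[X hX] := tail_ratio_cvg K.
  exists X; split; first exact: num_real.
  move=> x /hX h y; rewrite /F.
  have rK : r (x - K) / r x <= E K + 1 by move: h; rewrite ler_norml -/(E K) => /andP[_]; rewrite lerBlDl.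
  rewrite mulrCA normrM ler_pM ?rel_tail_norm// mulrBr (le_trans (ler_normB _ _))// lerD//.
    rewrite lvE; case: ifPn => [_|]; first by rewrite mul0r normr0 addr_ge0// expR_ge0.
    rewrite -leNgt mul1r => yK; apply: le_trans rK.
    rewrite ger0_norm ?divr_ge0 ?tail_ge0//.
    by rewrite ler_pM2r ?invr_gt0 ?r0// tail_homo// lerD2l lerN2.
  by rewrite ger0_norm// mulr_ge0// expR_ge0.
Qed.

(* [trunc]: one summand is at most [K]; [rem]: both exceed [K]. As [2 * K <= x], both
   summands cannot be at most [K]. *)
Let decomposition P Q K x : 2 * K <= x ->
  tail (convolution P Q) x = trunc P Q K x + trunc Q P K x + rem P Q K x.
Proof.
move=> Kx.
pose F (z : R * R) := heaviside (z.1 + z.2 - x).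
pose F1 (z : R * R) := lv K z.2 * F z.
pose F2 (z : R * R) := lv K z.1 * F z.
pose F3 (z : R * R) := heaviside (z.2 - K) * heaviside (z.1 - Num.max (x - z.2) K).
have m1 : measurable_fun setT (fun z : R * R => z.1) by exact: measurable_fst.
have m2 : measurable_fun setT (fun z : R * R => z.2) by exact: measurable_snd.
have mF : measurable_fun setT F.
  by apply: measurable_heaviside_comp; apply: measurable_funB => //; exact: measurable_addp.
have b2 (f h : R * R -> R) : (forall z, `|f z| <= 1) -> (forall z, `|h z| <= 1) ->
    forall z, `|f z * h z| <= 1.
  by move=> f1 h1 z; rewrite normrM -[1]mulr1 ler_pM.
have i1 : (P \x Q)%E.-itg F1.
  apply: (itg_prod_bdd _ _ _ 1); last by apply: b2 => z; [exact: lv_norm|exact: heaviside_norm].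
  by apply: measurable_funM => //; exact: (measurableT_comp (measurable_lv K)).
have i2 : (P \x Q)%E.-itg F2.
  apply: (itg_prod_bdd _ _ _ 1); last by apply: b2 => z; [exact: lv_norm|exact: heaviside_norm].
  by apply: measurable_funM => //; exact: (measurableT_comp (measurable_lv K)).
have i3 : (P \x Q)%E.-itg F3.
  apply: (itg_prod_bdd _ _ _ 1); last by apply: b2 => z; exact: heaviside_norm.
  apply: measurable_funM; apply: measurable_heaviside_comp; apply: measurable_funB => //.
  by apply: measurable_maxr => //; exact: measurable_funB.
have FE z : F z = F1 z + F2 z + F3 z.
  rewrite /F1 /F2 /F3 /F !lvE /heaviside !subr_gt0 gt_max.
  case: (ltP K z.2) => h2; case: (ltP K z.1) => h1; rewrite ?mul0r ?mul1r ?add0r ?addr0 ?andbT ?andbF//.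
  + by rewrite ltrBlDr.
  + by rewrite addr0.
  + have -> : (x < z.1 + z.2) = false by apply/negbTE; rewrite -leNgt (le_trans _ Kx)// mulr_natl mulr2n lerD.
    by rewrite !addr0.
have i12 := itgD _ _ _ i1 i2.
have iF : (P \x Q)%E.-itg F.
  by have := itgD _ _ _ i12 i3; apply: eq_integrable => // z _ /=; rewrite FE.
transitivity (\int[(P \x Q)%E]_z F z).
  rewrite tail_heaviside Rint_convolution; [exact: (Rint_Rint _ _ F)| |exact: iF].
  by apply: measurable_heaviside_comp; exact: measurable_funB.
transitivity (\int[(P \x Q)%E]_z (F1 z + F2 z + F3 z)).
  by apply: eq_Rintegral => z _; rewrite FE.
rewrite RintegralD// RintegralD// -(Rint_Rint _ _ F1)// -(Rint_Rint _ _ F2)// -(Rint_Rint _ _ F3)//.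
rewrite (Rint_fubini _ _ F1)// (Rint_fubini _ _ F3)//.
congr (_ + _ + _); apply: eq_Rintegral => y _.
- transitivity (\int[P]_t (lv K y * heaviside (t + y - x))); first by [].
  rewrite RintegralZl//; last by apply: itg_heaviside; apply: measurable_funB => //; exact: measurable_funD.
  by rewrite tail_heaviside; congr (_ * _); apply: eq_Rintegral => t _; congr heaviside; ring.
- transitivity (\int[Q]_t (lv K y * heaviside (y + t - x))); first by [].
  rewrite RintegralZl//; last by apply: itg_heaviside; apply: measurable_funB => //; exact: measurable_funD.
  by rewrite tail_heaviside; congr (_ * _); apply: eq_Rintegral => t _; congr heaviside; ring.
- transitivity (\int[P]_t (heaviside (y - K) * heaviside (t - Num.max (x - y) K))); first by [].
  rewrite RintegralZl//; last by apply: itg_heaviside; exact: measurable_funB.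
  by rewrite tail_heaviside.
Qed.

Let itg_rem P Q K x : Q.-itg (fun y => heaviside (y - K) * tail P (Num.max (x - y) K)).
Proof.
apply: (itg_bdd _ _ 1).
  apply: measurable_funM => //; apply: (measurableT_comp (measurable_tail P)).
  by apply: measurable_maxr => //; exact: measurable_funB.
by move=> y; rewrite normrM -[1]mulr1 ler_pM// ?tail_norm// heaviside_norm.
Qed.

Let rem_ge0 P Q K x : 0 <= rem P Q K x.
Proof. by apply: Rintegral_ge0 => y _; rewrite mulr_ge0 ?heaviside_ge0 ?tail_ge0. Qed.

(** Both sides are the probability that two independent summands exceed [K] and their sum exceeds
    [x]. The exchange lets [rem_le] dominate one factor after the other, reducing every remainder to
    that of [rho] with itself. *)
Let rem_sym P Q K x : rem P Q K x = rem Q P K x.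
Proof.
pose F (z : R * R) := heaviside (z.2 - K) * heaviside (z.1 - Num.max (x - z.2) K).
have m1 : measurable_fun setT (fun z : R * R => z.1) by exact: measurable_fst.
have m2 : measurable_fun setT (fun z : R * R => z.2) by exact: measurable_snd.
have iF : (P \x Q)%E.-itg F.
  apply: (itg_prod_bdd _ _ _ 1).
    apply: measurable_funM; apply: measurable_heaviside_comp; apply: measurable_funB => //.
    by apply: measurable_maxr => //; exact: measurable_funB.
  by move=> z; rewrite normrM -[1]mulr1 ler_pM// heaviside_norm.
have := Rint_fubini _ _ F iF.
have -> : \int[P]_s \int[Q]_t F (s, t) = rem Q P K x.
  apply: eq_Rintegral => s _.
  transitivity (\int[Q]_t (heaviside (s - K) * heaviside (t - Num.max (x - s) K))).
    apply: eq_Rintegral => t _; rewrite /F/= /heaviside !subr_gt0 !gt_max !ltrBlDr (addrC s).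
    by case: (K < t); case: (K < s); rewrite ?andbT ?andbF ?mul0r ?mul1r.
  rewrite RintegralZl//; last by apply: itg_heaviside; exact: measurable_funB.
  by rewrite tail_heaviside.
have -> : \int[Q]_t \int[P]_s F (s, t) = rem P Q K x.
  apply: eq_Rintegral => t _.
  transitivity (\int[P]_s (heaviside (t - K) * heaviside (s - Num.max (x - t) K))); first by [].
  rewrite RintegralZl//; last by apply: itg_heaviside; exact: measurable_funB.
  by rewrite tail_heaviside.
by [].
Qed.

Let rem_le1 P Q K x C : tail_dom C P -> rem P Q K x <= C * rem rho Q K x.
Proof.
move=> dP; rewrite -RintegralZl//; last exact: itg_rem.
apply: Rint_le => [||y]; [exact: itg_rem|by apply: itgZ; exact: itg_rem|].
by rewrite mulrCA ler_wpM2l ?heaviside_ge0.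
Qed.

Let rem_le P Q K x C D : tail_dom C P -> tail_dom D Q -> rem P Q K x <= C * D * rem rho rho K x.
Proof.
move=> dP dQ; have C0 := tail_dom_ge0 C P dP.
apply: (le_trans (rem_le1 _ _ K x _ dP)); rewrite -mulrA ler_wpM2l// rem_sym.
exact: rem_le1.
Qed.

Let heavisideE_cvg P : P.-itg E -> \int[P]_y (heaviside (y - K) * E y) @[K --> +oo] --> (0 : R).
Proof.
move=> iE; have -> : (0 : R) = \int[P]_y (0 : R) by rewrite Rintegral_cst// mul0r.
apply: (Rint_dct_pinfty P (fun K y => heaviside (y - K) * E y) (fun=> 0) E _ _ iE).
- by move=> K; apply: measurable_funM.
- move=> y; apply/cvgyP => e e0; exists y => K yK.
  by rewrite /heaviside subr_gt0 ltNge (ltW yK) mul0r subrr normr0 ltW.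
- near=> K => y; rewrite normrM (@ger0_norm _ (E y)) ?expR_ge0//.
  by rewrite ler_piMl ?expR_ge0// heaviside_norm.
Unshelve. all: by end_near.
Qed.

Lemma classS_itg : rho.-itg E.
Proof.
have [_ [m _]] := rhoS; apply/integrableP; split; first exact/measurable_EFinP.
by under eq_integral do rewrite /= ger0_norm ?expR_ge0//.
Qed.

Let m := \int[rho]_y E y.

Let m_gt0 : 0 < m.
Proof.
apply: (lt_le_trans (r0 0)); rewrite tail_heaviside; apply: Rint_le => [||y].
- by apply: itg_heaviside; exact: measurable_funB.
- exact: classS_itg.
- rewrite subr0 /heaviside; case: ifPn => y0; last exact: expR_ge0.
  by apply: le_trans (expR_ge1Dx _); rewrite lerDl mulr_ge0// ltW.
Qed.

Let conv_cvg : tail (convolution rho rho) x / r x @[x --> +oo] --> 2 * m.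
Proof.
have [_ [_ h]] := rhoS.
suff: 2 * m * (tail (Defs.conv rho rho) x / (2 * fine (mgf rho gam) * tail rho x)) @[x --> +oo] --> 2 * m * 1.
  rewrite mulr1; apply: cvg_trans; apply: near_eq_cvg; near=> x.
  have -> : tail (Defs.conv rho rho) x = tail (convolution rho rho) x.
    by rewrite /tail -convolutionE.
  have -> : fine (mgf rho gam) = m by [].
  rewrite -/(r x); move: (r0 x) m_gt0; rewrite -/(r x); move: (r x) m => rx m' rx0 m0.
  by field; rewrite !gt_eqF.
by apply: cvgM; [exact: cvg_cst|exact: h].
Unshelve. all: by end_near.
Qed.

Let itg_heavisideE P K : P.-itg E -> P.-itg (fun y => heaviside (y - K) * E y).
Proof. by move=> iE; apply: itg_bddM iE (measurable_heavisideK K) _ => y; exact: heaviside_norm. Qed.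

Let lv_heaviside P K h : P.-itg h -> \int[P]_y h y = \int[P]_y (lv K y * h y) + \int[P]_y (heaviside (y - K) * h y).
Proof.
move=> hi; have mh := itg_measurable _ _ hi.
have i1 : P.-itg (fun y => lv K y * h y) by exact: itg_bddM hi (measurable_lv K) (lv_norm K).
have i2 : P.-itg (fun y => heaviside (y - K) * h y).
  by apply: itg_bddM hi (measurable_heavisideK K) _ => y; exact: heaviside_norm.
rewrite -RintegralD//; apply: eq_Rintegral => y _; rewrite /lv; ring.
Qed.

(** Here the convolution condition of S(gamma) enters: the remainder is what the two truncated parts
    leave of the limit [2 * m], and this rest vanishes as [K] grows. *)
Let rem_cvg K : rem rho rho K x / r x @[x --> +oo] --> 2 * \int[rho]_y (heaviside (y - K) * E y).
Proof.
have d1 : tail_dom 1 rho by move=> x; rewrite mul1r.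
have t := trunc_cvg 1 rho rho K d1.
suff: tail (convolution rho rho) x / r x -
  (1 + 1) * (trunc rho rho K x / r x - \int[rho]_y (lv K y * (rel_tail rho (x - y) * E y)))
  - 2 * \int[rho]_y (lv K y * E y)
  @[x --> +oo] --> 2 * m - (1 + 1) * 0 - 2 * \int[rho]_y (lv K y * E y).
  have -> : 2 * m - (1 + 1) * 0 - 2 * \int[rho]_y (lv K y * E y) = 2 * \int[rho]_y (heaviside (y - K) * E y).
    by rewrite /m (lv_heaviside _ K _ classS_itg); ring.
  apply: cvg_trans; apply: near_eq_cvg; near=> x.
  have -> : \int[rho]_y (lv K y * (rel_tail rho (x - y) * E y)) = \int[rho]_y (lv K y * E y).
    by apply: eq_Rintegral => y _; rewrite /rel_tail divff ?mul1r// gt_eqF.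
  rewrite (decomposition rho rho K); last by near: x; apply: nbhs_pinfty_ge; exact: num_real.
  by field; rewrite gt_eqF// r0.
by apply: cvgB; [apply: cvgB; [exact: conv_cvg|apply: cvgM; [exact: cvg_cst|exact: t]]|exact: cvg_cst].
Unshelve. all: by end_near.
Qed.

(** [K] is fixed before [x] grows, so that the integral of [E] beyond [K] is small for [P], [Q] and
    [rho] at once. The first two complete the truncated integrals to full convolutions; the third
    controls the remainder. *)
Lemma rel_tail_convolution P Q C D : tail_dom C P -> tail_dom D Q -> P.-itg E -> Q.-itg E ->
  rel_tail (convolution P Q) x - wconv Q E (rel_tail P) x - wconv P E (rel_tail Q) x @[x --> +oo] --> (0 : R).
Proof.
move=> dP dQ iP iQ; have C0 := tail_dom_ge0 C P dP; have D0 := tail_dom_ge0 D Q dQ.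
have num_bound (t1 t2 u1 u2 q T1 T2 s : R) : `|t1 - u1| <= s -> `|t2 - u2| <= s ->
    `|T1| <= C * s -> `|T2| <= D * s -> q <= C * D * (3 * s) -> 0 <= q ->
    `|t1 + t2 + q - (u1 + T1) - (u2 + T2)| <= s * (2 + 3 * (C * D) + C + D).
  rewrite !ler_norml => /andP[? ?] /andP[? ?] /andP[? ?] /andP[? ?] ? ?.
  by apply/andP; split; lra.
apply/cvgyP => e e0.
have CD0 : 0 <= C * D by rewrite mulr_ge0.
(* The 2 comes from the two truncated limits, [C] and [D] from completing the integrals beyond [K],
   and [3 * (C * D)] from the remainder, whose limit is at most [2 * s] and is approached within
   [s]. *)
pose N := 2 + 3 * (C * D) + C + D; have N0 : 0 < N by rewrite /N; lra.
pose s := e / N; have s0 : 0 < s by rewrite divr_gt0.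
have [K1 hK1] := (cvgyP _ _).1 (heavisideE_cvg P iP) s s0.
have [K2 hK2] := (cvgyP _ _).1 (heavisideE_cvg Q iQ) s s0.
have [K3 hK3] := (cvgyP _ _).1 (heavisideE_cvg rho classS_itg) s s0.
pose K := Num.max K1 (Num.max K2 K3) + 1.
have mK : Num.max K1 (Num.max K2 K3) < K by rewrite ltrDl.
move: (mK); rewrite !gt_max => /andP[/hK1 {}hK1 /andP[/hK2 {}hK2 /hK3 {}hK3]].
rewrite !subr0 in hK1 hK2 hK3.
have [X1 h1] := (cvgyP _ _).1 (trunc_cvg C P Q K dP) s s0.
have [X2 h2] := (cvgyP _ _).1 (trunc_cvg D Q P K dQ) s s0.
have [X3 h3] := (cvgyP _ _).1 (rem_cvg K) s s0.
exists (Num.max (Num.max X1 X2) (Num.max X3 (2 * K))) => x.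
rewrite !gt_max => /andP[/andP[/h1 {}h1 /h2 {}h2] /andP[/h3 {}h3 xK]].
rewrite !subr0 in h1 h2 *.
have split_wconv (P' Q' : probability R R) B : tail_dom B P' -> Q'.-itg E ->
    \int[Q']_y (heaviside (y - K) * E y) <= s ->
    exists2 T, `|T| <= B * s & wconv Q' E (rel_tail P') x =
      \int[Q']_y (lv K y * (rel_tail P' (x - y) * E y)) + T.
  move=> dP' iQ' hs; have B0 := tail_dom_ge0 B P' dP'.
  have wi : Q'.-itg (fun y => rel_tail P' (x - y) * E y).
    apply: (wconv_itg _ _ _ B) => //; first exact: measurable_rel_tail.
    by move=> u; exact: rel_tail_norm.
  exists (\int[Q']_y (heaviside (y - K) * (rel_tail P' (x - y) * E y))); last by rewrite -(lv_heaviside _ K _ wi).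
  apply: (@le_trans _ _ (\int[Q']_y (B * (heaviside (y - K) * E y)))); last first.
    by rewrite RintegralZl//; [rewrite ler_wpM2l|exact: itg_heavisideE].
  apply: Rint_norm_le.
  - apply: measurable_funM => //; exact: itg_measurable wi.
  - by apply: itgZ; exact: itg_heavisideE.
  - move=> y; rewrite mulrCA normrM ler_pM ?rel_tail_norm//.
    by rewrite ger0_norm// mulr_ge0 ?heaviside_ge0// expR_ge0.
have [T1 hT1 ->] := split_wconv P Q C dP iQ (le_trans (ler_norm _) hK2).
have [T2 hT2 ->] := split_wconv Q P D dQ iP (le_trans (ler_norm _) hK1).
have remb : rem P Q K x / r x <= C * D * (3 * s).
  apply: (@le_trans _ _ (C * D * (rem rho rho K x / r x))).
    by rewrite mulrA ler_pM2r ?invr_gt0 ?r0//; exact: rem_le.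
  rewrite ler_wpM2l//.
  have := le_trans (ler_norm _) hK3; move: h3; rewrite ler_norml => /andP[_].
  by rewrite lerBlDr; lra.
have rem0 : 0 <= rem P Q K x / r x by rewrite divr_ge0// ltW// r0.
rewrite {1}/rel_tail -/r (decomposition P Q K x (ltW xK)) !mulrDl.
have Ns : e = s * N by rewrite /s divfK// gt_eqF.
by rewrite Ns; exact: num_bound.
Qed.

(** Up to [X], the tail of [P] is at most 1 and that of [rho] at least its positive value at [X]. *)
Lemma tail_dom_eventually P X C : (forall x, X < x -> rel_tail P x <= C) -> exists D, tail_dom D P.
Proof.
move=> h; exists (Num.max C (r X)^-1) => x; have [Xx|xX] := ltP X x.
  by rewrite -ler_pdivrMr ?r0// le_max h.
rewrite -ler_pdivrMr ?r0// le_max; apply/orP; right.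
rewrite -[leRHS]mul1r ler_pM ?tail_ge0 ?tail_le1 ?invr_ge0 ?tail_ge0//.
by rewrite lef_pV2 ?posrE ?r0// tail_homo.
Qed.

Lemma tail_dom_convolution P Q C D : tail_dom C P -> tail_dom D Q -> P.-itg E -> Q.-itg E ->
  exists B, tail_dom B (convolution P Q).
Proof.
move=> dP dQ iP iQ.
have [X hX] := (cvgyP _ _).1 (rel_tail_convolution P Q C D dP dQ iP iQ) 1 ltr01.
apply: (tail_dom_eventually _ X (1 + C * \int[Q]_y `|E y| + D * \int[P]_y `|E y|)) => x /hX.
have h1 := wconv_bound Q E (rel_tail P) C x iQ (measurable_rel_tail P) (fun u => rel_tail_norm C P u dP).
have h2 := wconv_bound P E (rel_tail Q) D x iP (measurable_rel_tail Q) (fun u => rel_tail_norm D Q u dQ).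
have := le_trans (ler_norm _) h1; have := le_trans (ler_norm _) h2.
rewrite subr0 ler_norml; lra.
Qed.
End big_jump.

(** * Convolution roots *)

Section tilted.
Context {R : realType}.
Variable gam : R.
Implicit Types (P Q : probability R R) (f : R -> R) (x y z A : R).

Let E y : R := expR (gam * y).

Let measurable_E : measurable_fun setT E.
Proof. by apply: (measurableT_comp (f := expR)) => //; exact: measurable_funM. Qed.

Let ED x y : E (x + y) = E x * E y.
Proof. by rewrite /E mulrDr expRD. Qed.

Let itg_prodE P Q f A : P.-itg E -> Q.-itg E -> measurable_fun setT f -> (forall x, `|f x| <= A) ->
  (P \x Q)%E.-itg (fun z : R * R => f (z.1 + z.2) * E (z.1 + z.2)).
Proof.
move=> iP iQ mf fA.
have := itg_bddM _ (fun z : R * R => f (z.1 + z.2)) _ A (itg_prod _ _ _ _ iP iQ)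
  (measurableT_comp mf measurable_addp) (fun=> fA _).
by apply: eq_integrable => // z _ /=; rewrite ED.
Qed.

Lemma itg_expR_convolution P Q : P.-itg E -> Q.-itg E -> (convolution P Q).-itg E.
Proof.
move=> iP iQ; apply: itg_convolution => //.
have := itg_prod _ _ _ _ iP iQ; apply: eq_integrable => // z _ /=.
by rewrite ED.
Qed.

Lemma Rint_expR_convolution P Q f A : P.-itg E -> Q.-itg E -> measurable_fun setT f -> (forall x, `|f x| <= A) ->
  \int[convolution P Q]_t (f t * E t) = \int[P]_s \int[Q]_y (f (s + y) * (E s * E y)).
Proof.
move=> iP iQ mf fA; rewrite (Rint_convolution P Q (fun t => f t * E t)).
- by apply: eq_Rintegral => s _; apply: eq_Rintegral => y _; rewrite ED.
- exact: measurable_funM.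
- exact: itg_prodE fA.
Qed.

Lemma wconv_convolution P Q f A x : P.-itg E -> Q.-itg E -> measurable_fun setT f -> (forall x, `|f x| <= A) ->
  wconv (convolution P Q) E f x = wconv Q E (wconv P E f) x.
Proof.
move=> iP iQ mf fA.
have mfx : measurable_fun setT (fun t : R => f (x - t)) by exact: measurable_reflect.
rewrite /wconv (Rint_expR_convolution P Q (fun t => f (x - t)) A)//.
have Fi := itg_prodE P Q (fun t => f (x - t)) A iP iQ mfx (fun=> fA _).
pose F (z : R * R) := f (x - (z.1 + z.2)) * (E z.1 * E z.2).
have {}Fi : (P \x Q)%E.-itg F by apply: eq_integrable Fi => // z _ /=; rewrite ED.
rewrite (Rint_fubini _ _ F)//; apply: eq_Rintegral => y _.
rewrite -RintegralZr//; last exact: (wconv_itg _ _ _ A).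
by apply: eq_Rintegral => s _; rewrite /F/= mulrA; congr (f _ * _ * _); ring.
Qed.

(** With [esin], the real and imaginary parts of the transform at [gam + i z]; the convolution
    formulas below are complex multiplication. *)
Definition ecos P z := \int[P]_y (cos (z * y) * E y).
Definition esin P z := \int[P]_y (sin (z * y) * E y).

Let itg_cosE P z : P.-itg E -> P.-itg (fun y => cos (z * y) * E y).
Proof. by move=> iP; exact: itg_bddM iP (measurable_cosM z) (fun=> cos_norm_le _). Qed.

Let itg_sinE P z : P.-itg E -> P.-itg (fun y => sin (z * y) * E y).
Proof. by move=> iP; exact: itg_bddM iP (measurable_sinM z) (fun=> sin_norm_le _). Qed.

Lemma ecos_convolution P Q z : P.-itg E -> Q.-itg E ->
  ecos (convolution P Q) z = ecos P z * ecos Q z - esin P z * esin Q z.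
Proof.
move=> iP iQ; have iC := itg_cosE _ z iP; have iS := itg_sinE _ z iP.
have jC := itg_cosE _ z iQ; have jS := itg_sinE _ z iQ.
rewrite {1}/ecos (Rint_expR_convolution P Q _ 1 iP iQ (measurable_cosM z) (fun=> cos_norm_le _)).
rewrite [ecos P z]/ecos [esin P z]/esin -!RintegralZr// -RintegralB//.
- apply: eq_Rintegral => s _; rewrite [ecos Q z]/ecos [esin Q z]/esin -!RintegralZl// -RintegralB//; try exact: itgZ.
  by apply: eq_Rintegral => y _; rewrite mulrDr cosD; ring.
- by have := itgZ _ _ (ecos Q z) iC; apply: eq_integrable => // s _ /=; rewrite mulrC.
- by have := itgZ _ _ (esin Q z) iS; apply: eq_integrable => // s _ /=; rewrite mulrC.
Qed.

Lemma esin_convolution P Q z : P.-itg E -> Q.-itg E ->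
  esin (convolution P Q) z = esin P z * ecos Q z + ecos P z * esin Q z.
Proof.
move=> iP iQ; have iC := itg_cosE _ z iP; have iS := itg_sinE _ z iP.
have jC := itg_cosE _ z iQ; have jS := itg_sinE _ z iQ.
rewrite {1}/esin (Rint_expR_convolution P Q _ 1 iP iQ (measurable_sinM z) (fun=> sin_norm_le _)).
rewrite [ecos P z]/ecos [esin P z]/esin -!RintegralZr// -RintegralD//.
- apply: eq_Rintegral => s _; rewrite [ecos Q z]/ecos [esin Q z]/esin -!RintegralZl// -RintegralD//; try exact: itgZ.
  by apply: eq_Rintegral => y _; rewrite mulrDr sinD; ring.
- by have := itgZ _ _ (ecos Q z) iS; apply: eq_integrable => // s _ /=; rewrite mulrC.
- by have := itgZ _ _ (\int[Q]_y (sin (z * y) * E y)) iC; apply: eq_integrable => // s _ /=; rewrite mulrC.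
Qed.

Lemma Rint_dirac f (a : R) : measurable_fun setT f -> \int[(\d_a : probability R R)]_y f y = f a.
Proof.
move=> mf; rewrite /Rintegral integral_dirac//; last exact/measurable_EFinP.
by rewrite diracT mul1e.
Qed.

Lemma itg_dirac f (a : R) : measurable_fun setT f -> (\d_a : probability R R).-itg f.
Proof.
move=> mf; apply/integrableP; split; first exact/measurable_EFinP.
rewrite integral_dirac//; last by apply/measurable_EFinP; exact: measurableT_comp.
by rewrite diracT mul1e ltry.
Qed.

(** The squared modulus is multiplicative under convolution, by the two-squares identity, so it
    stays positive. *)
Lemma conv_pow_fourier P n z : P.-itg E -> (forall z, ecos P z <> 0 \/ esin P z <> 0) ->
  (conv_pow P n).-itg E /\ (ecos (conv_pow P n) z <> 0 \/ esin (conv_pow P n) z <> 0).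
Proof.
move=> iP nz; elim: n => [|n [IHi IHn]].
  split; first exact: itg_dirac.
  left; rewrite /ecos Rint_dirac; last by apply: measurable_funM => //; exact: measurable_cosM.
  by rewrite /E !mulr0 cos0 expR0 mulr1; apply/eqP; exact: oner_neq0.
split; first exact: itg_expR_convolution.
have sq (a b : R) : a <> 0 \/ b <> 0 -> 0 < a ^+ 2 + b ^+ 2.
  case=> /eqP h; first by rewrite ltr_pwDl ?sqr_ge0// exprn_even_gt0.
  by rewrite ltr_wpDl ?sqr_ge0// exprn_even_gt0.
have := mulr_gt0 (sq _ _ IHn) (sq _ _ (nz z)).
rewrite (_ : _ * _ = (ecos (convolution (conv_pow P n) P) z) ^+ 2 + (esin (convolution (conv_pow P n) P) z) ^+ 2); last first.
  by rewrite ecos_convolution// esin_convolution//; ring.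
move=> h; have [c0|/eqP] := eqVneq (ecos (conv_pow P n.+1) z) 0; last by left.
have [s0|/eqP] := eqVneq (esin (conv_pow P n.+1) z) 0; last by right.
by move: h; rewrite [ecos _ _]c0 [esin _ _]s0 expr0n/= addr0 ltxx.
Qed.
End tilted.

(** * Tails of the root and of its convolution powers *)

Section roots.
Context {R : realType}.
Variables (gam : R) (rho mu : probability R R).
Hypotheses (gam0 : 0 < gam) (rhoS : classS gam rho).
Implicit Types (P Q : probability R R) (x y K C : R).

Let r := tail rho.
Let E y : R := expR (gam * y).
Let f := rel_tail rho mu.

Hypothesis imu : mu.-itg E.

Let r0 := classS_tail_gt0 gam rho rhoS.

Let measurable_E : measurable_fun setT E.
Proof. by apply: (measurableT_comp (f := expR)) => //; exact: measurable_funM. Qed.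

Lemma exists_tail_gt0 P : exists a, 0 < tail P a.
Proof.
have : \int[P]_y heaviside (y + a) @[a --> +oo] --> \int[P]_y (1 : R).
  apply: (Rint_dct_pinfty P (fun a y => heaviside (y + a)) (fun=> 1) (cst 1)).
  - by move=> a; apply: measurable_heaviside_comp; exact: measurable_funD.
  - move=> y; apply/cvgyP => e e0; exists (- y) => a ya.
    rewrite /heaviside (_ : 0 < y + a); last by rewrite -subr_gt0 opprK addrC in ya.
    by rewrite subrr normr0 ltW.
  - exact: finite_measure_integrable_cst.
  - by near=> a => y; exact: heaviside_norm.
have -> : \int[P]_y (1 : R) = 1.
  by rewrite Rintegral_cst// mul1r; exact: (congr1 fine (probability_setT P)).
move=> /cvgyP/(_ (2^-1)).
rewrite invr_gt0 ltr0n => /(_ isT)[X hX]; exists (- (X + 1)).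
have := hX (X + 1); rewrite ltrDl ltr01 => /(_ isT).
rewrite tail_heaviside; under [X in _ -> _ < X]eq_Rintegral do rewrite opprK.
by rewrite ler_norml => /andP[+ _]; lra.
Unshelve. all: by end_near.
Qed.

(** A sum exceeds [x] as soon as the [P]-part exceeds [a] and the [Q]-part exceeds [x - a]. For an
    [a] where [P] has positive tail this dominates the tail of [Q] by a shift of rho's tail, and
    class L(gamma) turns the shift into a constant. This is the source of the boundedness of [f]. *)
Lemma tail_dom_factor P Q : (forall x, tail rho x = tail (convolution P Q) x) -> exists C, tail_dom rho C Q.
Proof.
move=> rE; have [a a0] := exists_tail_gt0 P.
have le x : tail Q (x - a) * tail P a <= r x.
  rewrite /r rE tail_convolution tail_heaviside -RintegralZr//; last by apply: itg_heaviside; exact: measurable_funB.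
  apply: Rint_le => [||y].
  - apply: (itg_bdd _ _ (1 * 1)).
      by apply: measurable_funM => //; apply: measurable_heaviside_comp; exact: measurable_funB.
    by move=> y; rewrite normrM ler_pM ?tail_norm// heaviside_norm.
  - apply: (itg_bdd _ _ 1); last by move=> y; exact: tail_norm.
    by apply: measurable_reflect; exact: measurable_tail.
  - rewrite /heaviside; case: ifPn => h; last by rewrite mul0r tail_ge0.
    by rewrite mul1r tail_homo//; lra.
have [X hX] := (cvgyP _ _).1 (tail_ratio_cvg gam rho rhoS (- a)) 1 ltr01.
apply: (tail_dom_eventually gam rho rhoS Q X ((expR (gam * - a) + 1) / tail P a)) => x /hX.
rewrite ler_norml => /andP[_]; rewrite opprK lerBlDl => h.
rewrite ler_pdivlMr//; apply: le_trans h.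
rewrite /rel_tail mulrAC ler_pM2r ?invr_gt0 ?r0//.
by have := le (x + a); rewrite addrK.
Qed.

Let dirac_tail_dom : exists C, tail_dom rho C (\d_(0 : R)).
Proof.
apply: (tail_dom_eventually gam rho rhoS _ 0 0) => x x0.
rewrite /rel_tail tail_heaviside Rint_dirac; last by apply: measurable_heaviside_comp; exact: measurable_funB.
by rewrite /heaviside sub0r oppr_gt0 ltNge (ltW x0) mul0r.
Qed.

Variable C : R.
Hypothesis dmu : tail_dom rho C mu.

Let mf : measurable_fun setT f := measurable_rel_tail gam rho rhoS mu.
Let fC x : `|f x| <= C := rel_tail_norm gam rho rhoS C mu x dmu.

(* Exactly one of the [n.+1] summands is large, whence the factor [n.+1]. *)
Lemma conv_pow_asymptotics n : [/\ (conv_pow mu n).-itg E, exists D, tail_dom rho D (conv_pow mu n) &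
  rel_tail rho (conv_pow mu n.+1) x - n.+1%:R * wconv (conv_pow mu n) E f x @[x --> +oo] --> (0 : R)].
Proof.
elim: n => [|n [IHi [D IHd] IHc]].
  split => //; first exact: itg_dirac.
  apply/cvgyP => e e0; exists 0 => x _.
  have -> : wconv (conv_pow mu 0) E f x = f x.
    rewrite /wconv Rint_dirac; first by rewrite subr0 /E mulr0 expR0 mulr1.
    by apply: measurable_funM => //; apply: measurable_reflect.
  have -> : rel_tail rho (conv_pow mu 1) x = f x.
    rewrite /f /rel_tail; congr (_ / _).
    transitivity (tail (convolution (conv_pow mu 0) mu) x); first by [].
    rewrite tail_convolution tail_heaviside; apply: eq_Rintegral => y _.
    rewrite tail_heaviside Rint_dirac; last by apply: measurable_heaviside_comp; exact: measurable_funB.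
    by congr heaviside; ring.
  by rewrite mul1r !subrr normr0 ltW.
have iP : (convolution (conv_pow mu n) mu).-itg E by exact: itg_expR_convolution.
have [B dB] := tail_dom_convolution gam rho gam0 rhoS (conv_pow mu n) mu D C IHd dmu IHi imu.
split; [exact: iP|by exists B|].
have key := rel_tail_convolution gam rho gam0 rhoS (convolution (conv_pow mu n) mu) mu B C dB dmu iP imu.
(* The error [h] of the previous power is bounded and tends to 0, hence so does its convolution with
   [mu]. A jump among the previous summands contributes [n.+1] copies of the new weighted
   convolution, and a jump of the last summand one more. *)
pose h x := rel_tail rho (conv_pow mu n.+1) x - n.+1%:R * wconv (conv_pow mu n) E f x.
have mw : measurable_fun setT (wconv (conv_pow mu n) E f) by exact: measurable_wconv.
have mh : measurable_fun setT h.
  by apply: measurable_funB; [exact: measurable_rel_tail rhoS _|exact: measurable_funM].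
pose W := C * \int[conv_pow mu n]_y `|E y|.
have wW x : `|wconv (conv_pow mu n) E f x| <= W by exact: wconv_bound.
have wW' x : `|n.+1%:R * wconv (conv_pow mu n) E f x| <= n.+1%:R * W.
  by rewrite normrM ger0_norm// ler_wpM2l.
have rB x : `|rel_tail rho (conv_pow mu n.+1) x| <= B := rel_tail_norm gam rho rhoS B _ x dB.
have hb x : `|h x| <= B + n.+1%:R * W by apply: (le_trans (ler_normB _ _)); exact: lerD.
have h0 := wconv_cvg0 mu E h _ imu mh hb IHc.
suff: (rel_tail rho (convolution (convolution (conv_pow mu n) mu) mu) x - wconv mu E (rel_tail rho (convolution (conv_pow mu n) mu)) x
    - wconv (convolution (conv_pow mu n) mu) E (rel_tail rho mu) x) + wconv mu E h x @[x --> +oo] --> (0 + 0 : R).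
  rewrite addr0; apply: cvg_trans; apply: near_eq_cvg; near=> x.
  rewrite (wconvB mu E _ _ B (n.+1%:R * W) x imu (measurable_rel_tail gam rho rhoS _) rB)//; last exact: measurable_funM.
  rewrite (wconvZ mu E _ W)// -(wconv_convolution gam (conv_pow mu n) mu f C)//.
  rewrite -/f -[in n.+2%:R]addn1 natrD; ring.
by apply: cvgD.
Unshelve. all: by end_near.
Qed.

Hypothesis nz : forall z, ecos gam mu z <> 0 \/ esin gam mu z <> 0.
Variable n : nat.
Hypothesis rhoE : forall x, tail rho x = tail (conv_pow mu n.+1) x.

(** The numerator of [f] can only decrease, so growth comes from the denominator, where
    [r x / r (x + d)] tends to [expR (gam * d)]. The choice of [d] makes this the square root of
    [1 + e], leaving room below [1 + e] for the convergence. *)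
Let f_slow e : 0 < e -> exists2 d, 0 < d & exists X, forall x t, X < x -> 0 <= t <= d ->
  f (x + t) <= (1 + e) * f x.
Proof.
move=> e0; have e1 : 1 < 1 + e by rewrite ltrDl.
have l0 : 0 < ln (1 + e) by rewrite ln_gt0.
pose d := ln (1 + e) / 2 / gam.
have d0 : 0 < d by rewrite !divr_gt0.
exists d => //.
have Ed : expR (gam * d) < 1 + e.
  have -> : gam * d = ln (1 + e) / 2 by rewrite /d mulrC divfK// gt_eqF.
  rewrite -[ltRHS](lnK (_ : 1 + e \is Num.pos)); last by rewrite posrE (lt_trans ltr01).
  by rewrite ltr_expR; lra.
have Ed0 : 0 < 1 + e - expR (gam * d) by rewrite subr_gt0.
have [X hX] := (cvgyP _ _).1 (tail_ratio_cvg gam rho rhoS d) _ Ed0.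
exists X => x t xX /andP[t0 td]; rewrite /f /rel_tail.
have := hX (x + d); rewrite addrK (lt_trans xX) ?ltrDl// => /(_ isT).
rewrite ler_norml => /andP[_]; rewrite lerBlDl subrKC => h.
apply: (@le_trans _ _ (tail mu x / r (x + d))).
  apply: ler_pM; rewrite ?tail_ge0 ?invr_ge0 ?tail_ge0 ?tail_homo ?lerDl//.
  by rewrite lef_pV2 ?posrE ?r0// tail_homo// lerD2l.
have -> : tail mu x / r (x + d) = (r x / r (x + d)) * (tail mu x / r x).
  by field; rewrite !gt_eqF// r0.
by rewrite ler_wpM2r// divr_ge0 ?tail_ge0.
Qed.

Let c : R := (n.+1%:R * \int[conv_pow mu n]_y E y)^-1.

Let mass_gt0 : 0 < \int[conv_pow mu n]_y E y.
Proof.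
rewrite lt_neqAle Rintegral_ge0 ?andbT; last by move=> y _; exact: expR_ge0.
(* At frequency 0 the sine integral vanishes, so nonvanishing of the transform means that the mass
   is nonzero. *)
apply/eqP => z0; have [_] := conv_pow_fourier gam mu n 0 imu nz.
rewrite /ecos /esin.
under eq_Rintegral do rewrite mul0r cos0 mul1r.
under [X in _ \/ X <> _]eq_Rintegral do rewrite mul0r sin0 mul0r.
by rewrite -/(E _) Rintegral_cst// mul0r => -[]; [rewrite -z0|].
Qed.

Let c_gt0 : 0 < c.
Proof. by rewrite invr_gt0 mulr_gt0. Qed.

Lemma rel_tail_root_cvg : f x @[x --> +oo] --> c.
Proof.
have [iP _ asy] := conv_pow_asymptotics n.
apply: (wiener_pitt (conv_pow mu n) E f C c iP) => //.
- by move=> z; have [_] := conv_pow_fourier gam mu n z imu nz.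
- by move=> x; apply/andP; split; [exact: rel_tail_ge0|exact: (rel_tail_le gam rho rhoS C)].
have -> : c * \int[conv_pow mu n]_y E y = (1 - 0) / n.+1%:R.
  by rewrite /c subr0 invfM mul1r mulfVK// gt_eqF.
suff: (1 - (rel_tail rho (conv_pow mu n.+1) x - n.+1%:R * wconv (conv_pow mu n) E f x)) / n.+1%:R @[x --> +oo]
    --> ((1 - 0) / n.+1%:R : R).
  apply: cvg_trans; apply: near_eq_cvg; near=> x.
  have -> : rel_tail rho (conv_pow mu n.+1) x = 1 by rewrite /rel_tail -rhoE divff// gt_eqF.
  by rewrite opprB addrC subrK mulrC mulKf// pnatr_eq0.
by apply: cvgM; [apply: cvgB; [exact: cvg_cst|exact: asy]|exact: cvg_cst].
Unshelve. all: by end_near.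
Qed.

(** As [f] tends to [c > 0], the shift asymptotics pass from [rho] to [mu]. For the convolution
    condition the big jump estimate is used once more with both factors equal to [mu]: each weighted
    convolution of [f] now has the limit [c] times the mass of [E], and dividing by [f] removes
    [c]. *)
Lemma classS_root : (mgf mu gam < +oo)%E -> classS gam mu.
Proof.
move=> mfin.
have fc := rel_tail_root_cvg.
have [X hX] := (cvgyP _ _).1 fc (c / 2) (divr_gt0 c_gt0 (ltr0n _ 2)).
have fpos x : X < x -> 0 < f x.
  by move=> /hX; rewrite ler_norml => /andP[+ _]; have := c_gt0; lra.
(* The limit gives positivity only for large arguments; monotonicity of the tail extends it to
   all. *)
have tpos x : 0 < tail mu x.
  have h : 0 < tail mu (Num.max x (X + 1)).
    rewrite -(rel_tailM gam rho rhoS) mulr_gt0 ?r0// -/f fpos//.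
    by rewrite lt_max ltrDl ltr01 orbT.
  by apply: (lt_le_trans h); rewrite tail_homo// le_max lexx.
have cn0 : c != 0 by rewrite gt_eqF// c_gt0.
have m0 : 0 < \int[mu]_y E y.
  rewrite lt_neqAle Rintegral_ge0 ?andbT; last by move=> y _; exact: expR_ge0.
  apply/eqP => z0; have := nz 0; rewrite /ecos /esin.
  under eq_Rintegral do rewrite mul0r cos0 mul1r.
  under [X in _ \/ X <> _]eq_Rintegral do rewrite mul0r sin0 mul0r.
  by rewrite -/(E _) Rintegral_cst// mul0r => -[]; [rewrite -z0|].
split; first split => // a.
  have [[_ /(_ a) h] _] := rhoS.
  suff: f (x + a) / f x * (tail rho (x + a) / (expR (- gam * a) * tail rho x)) @[x --> +oo] --> c / c * 1.
    rewrite mulr1 divff//; apply: cvg_trans; apply: near_eq_cvg; near=> x.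
    rewrite /f /rel_tail; have e0 := expR_gt0 (- gam * a); have := r0 x; have := r0 (x + a); have := tpos x.
    move: (tail mu x) (tail rho x) (tail rho (x + a)) (expR _) e0 => u v w z *.
    by field; rewrite !gt_eqF.
  apply: cvgM => //; apply: cvgM; first exact: cvgy_shift.
  by apply: cvgV.
split => //.
have iP := imu.
have key := rel_tail_convolution gam rho gam0 rhoS mu mu C C dmu dmu imu imu.
have wcc : wconv mu E f x @[x --> +oo] --> c * \int[mu]_y E y.
  have fcb x : `|f x - c| <= C + `|c| by rewrite (le_trans (ler_normB _ _))// lerD2r.
  have mfc : measurable_fun setT (fun x => f x - c) by exact: measurable_funB.
  have fc0 : f x - c @[x --> +oo] --> (0 : R).
    suff: f x - c @[x --> +oo] --> c - c by rewrite subrr.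
    by apply: cvgB => //; exact: cvg_cst.
  have := wconv_cvg0 mu E _ _ imu mfc fcb fc0 => h.
  suff: wconv mu E (fun x => f x - c) x + c * (\int[mu]_y E y) @[x --> +oo] --> 0 + c * \int[mu]_y E y.
    rewrite add0r; apply: cvg_trans; apply: near_eq_cvg; near=> x.
    by rewrite (wconvB mu E f (fun=> c) C `|c|)// wconv_cst// subrK.
  by apply: cvgD => //; exact: cvg_cst.
set M := \int[mu]_y E y in m0 wcc *.
have mE : fine (mgf mu gam) = M by [].
rewrite /asym_equiv mE.
suff: (rel_tail rho (convolution mu mu) x - wconv mu E f x - wconv mu E f x + wconv mu E f x + wconv mu E f x)
    / (2 * M * f x) @[x --> +oo] --> (0 + c * M + c * M) / (2 * M * c).
  have -> : (0 + c * M + c * M) / (2 * M * c) = 1 by field; rewrite cn0 gt_eqF.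
  apply: cvg_trans; apply: near_eq_cvg; near=> x.
  have -> : tail (Defs.conv mu mu) x = tail (convolution mu mu) x by rewrite /tail -convolutionE.
  rewrite /f /rel_tail -/f; have rp := r0 x; have tp := tpos x; move: rp tp.
  move: (wconv mu E f x) (tail (convolution mu mu) x) (tail mu x) (tail rho x) => w u v t t0 v0.
  by field; rewrite !gt_eqF.
apply: cvgM.
  apply: cvgD => //; apply: cvgD => //.
apply: cvgV; first by rewrite !mulf_neq0// gt_eqF.
by apply: cvgM => //; exact: cvg_cst.
Unshelve. all: by end_near.
Qed.
End roots.

Theorem theorem1p3 (R : realType) (g : R) (mu : probability R R) :
  0 < g ->
  (mgf mu g < +oo)%E ->
  (forall z : R, cmgf_re mu g z <> 0 \/ cmgf_im mu g z <> 0) ->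
  (exists n : nat, exists rho : probability R R,
      (forall A : set R, measurable A -> rho A = convpow mu n A) /\ classS g rho) ->
  classS g mu.
Proof.
move=> g0 mfin nz [[|n] [rho [rhoE rhoS]]].
  (* The power 0 is the Dirac mass at 0, whose tail vanishes at 1, so it cannot belong to the
     class. *)
  have := classS_tail_gt0 g rho rhoS 1.
  rewrite /tail rhoE//= indicE memNset ?ltxx//= in_itv/= andbT.
  by rewrite ltNge ler01.
have imu : mu.-itg (fun y => expR (g * y)).
  apply/integrableP; split.
    apply/measurable_EFinP; apply: (measurableT_comp (f := expR)) => //; exact: measurable_funM.
  by under eq_integral do rewrite /= ger0_norm ?expR_ge0//.
have rE x : tail rho x = tail (conv_pow mu n.+1) x by rewrite /tail rhoE// conv_powE.
have [C dC] := tail_dom_factor g rho rhoS (conv_pow mu n) mu rE.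
apply: (classS_root g rho mu g0 rhoS imu C dC _ n rE mfin) => z.
have := nz z; rewrite /cmgf_re /cmgf_im /ecos /esin /Rintegral.
by under eq_integral do rewrite mulrC; under [X in _ \/ fine X <> _]eq_integral do rewrite mulrC.
Qed.
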